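(* Let $G=A\ast_C$ be an HNN extension of topological groups, where $A$ is a compactly generated TDLC group and $C$ is a compact open subgroup of $G$. Then $G$ is hyperbolic if and only if $A$ is hyperbolic.
   Context: All topological groups are Hausdorff. A TDLC group is a totally disconnected locally compact group. A topological group is compactly generated if it is algebraically generated by a compact subset. Edges of graphs have length one. HNN extension: $C$ is an open subgroup of $A$, $\alpha$ is a topological isomorphism from $C$ onto an open subgroup of $A$, and $A\ast_C=\langle A,t\mid t^{-1}ct=\alpha(c)\ \text{for all } c\in C\rangle$, with the unique group topology for which the inclusion of $A$ is an open topological embedding. A Cayley-Abels graph of a compactly generated TDLC group $G$ is a locally finite connected graph on which $G$ acts, transitively on vertices, with compact open vertex stabilizers (it exists and is unique up to quasiisometry). A TDLC group is hyperbolic if it is compactly generated and some (hence any) Cayley-Abels graph of it is Gromov hyperbolic. *)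

(* Defs.v *)
From HB Require Import structures.
From mathcomp Require Import all_boot all_order all_algebra.
From mathcomp Require Import all_classical all_reals all_analysis.

Set Implicit Arguments.
Unset Strict Implicit.
Unset Printing Implicit Defensive.

Import Order.TTheory GRing.Theory Num.Theory.

Local Open Scope classical_set_scope.
Local Open Scope group_scope.

(* Topological groups are Hausdorff by convention. *)
HB.mixin Record isTopologicalGroup G of Group G & Topological G := {
  mulg_continuous : continuous (fun p : G * G => p.1 * p.2 : G);
  invg_continuous : continuous (fun x : G => x^-1 : G);
  topologicalGroup_hausdorff : hausdorff_space G }.

#[short(type="topologicalGroupType")]
HB.structure Definition TopologicalGroup :=
  {G of isTopologicalGroup G & Group G & Topological G}.

Definition subgroup (G : groupType) : set (set G) :=
  [set H | [/\ H 1, (forall x y, H x -> H y -> H (x * y))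
             & forall x, H x -> H x^-1]].

Definition tdlc (G : topologicalGroupType) : Prop :=
  totally_disconnected [set: G] /\ locally_compact [set: G].

Definition compactly_generated (G : topologicalGroupType) : Prop :=
  exists2 K : set G, compact K & smallest (@subgroup G) K = setT.

(* alpha is a topological isomorphism from C onto alpha(C); the values of this
   total function outside C are never used. *)
Definition topological_isomorphism (A : topologicalGroupType) (C : set A)
    (alpha : A -> A) : Prop :=
  [/\ (forall x y, C x -> C y -> alpha (x * y) = alpha x * alpha y),
      {within C, continuous alpha}
    & exists2 beta : A -> A,
        (forall x, C x -> beta (alpha x) = x)
        & {within alpha @` C, continuous beta}].

Section Presentation.
Variables (A : groupType) (C : set A) (alpha : A -> A).

Inductive hnn_letter := Base of A | Stable | StableInv.

Definition hnn_word := seq hnn_letter.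

(* The defining relations of < A, t | t^-1 c t = alpha c for c in C >. *)
Inductive hnn_rel : hnn_word -> hnn_word -> Prop :=
| hnn_rel_one : hnn_rel [:: Base 1] [::]
| hnn_rel_mul a b : hnn_rel [:: Base a; Base b] [:: Base (a * b)]
| hnn_rel_stableK : hnn_rel [:: Stable; StableInv] [::]
| hnn_rel_stableVK : hnn_rel [:: StableInv; Stable] [::]
| hnn_rel_conj c : C c ->
    hnn_rel [:: StableInv; Base c; Stable] [:: Base (alpha c)].

Inductive hnn_eq : hnn_word -> hnn_word -> Prop :=
| hnn_eq_rel w1 w2 u v : hnn_rel u v -> hnn_eq (w1 ++ u ++ w2) (w1 ++ v ++ w2)
| hnn_eq_refl w : hnn_eq w w
| hnn_eq_sym u v : hnn_eq u v -> hnn_eq v u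
| hnn_eq_trans u v w : hnn_eq u v -> hnn_eq v w -> hnn_eq u w.

Variables (G : groupType) (i : A -> G) (t : G).

Definition hnn_letter_val (l : hnn_letter) : G :=
  match l with Base a => i a | Stable => t | StableInv => t^-1 end.

Fixpoint hnn_eval (w : hnn_word) : G :=
  if w is l :: w' then hnn_letter_val l * hnn_eval w' else 1.

(* The evaluation of words identifies the presented group with G; in
   particular i is a group morphism and t^-1 (i c) t = i (alpha c) on C. *)
Definition hnn_presented : Prop :=
  (forall g, exists w, hnn_eval w = g) /\
  (forall u v, hnn_eval u = hnn_eval v <-> hnn_eq u v).

End Presentation.

(* G is the topological HNN extension of A along alpha : C -> alpha(C), with
   inclusion i : A -> G and stable letter t. Such a group topology on the
   presented group is unique, so there is no choice left in G. *)
Record hnn_extension (A G : topologicalGroupType) (C : set A) (alpha : A -> A)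
    (i : A -> G) (t : G) : Prop := HnnExtension {
  hnn_subgroup : subgroup C;
  hnn_open : open C;
  hnn_iso : topological_isomorphism C alpha;
  hnn_image_open : open (alpha @` C);
  hnn_presentation : hnn_presented C alpha i t;
  hnn_injective : injective i;
  hnn_continuous : continuous i;
  hnn_open_map : forall U : set A, open U -> open (i @` U) }.

Fixpoint walk (V : Type) (adj : V -> V -> Prop) (n : nat) (u v : V) : Prop :=
  if n is m.+1 then exists2 w, adj u w & walk adj m w v else u = v.

Section Realization.
Local Open Scope ring_scope.
Variables (R : realType) (V : Type) (adj : V -> V -> Prop).

(* Points of the geometric realization. EdgePoint u v s is the point at
   distance s from u on the unit edge from u to v; a point has several
   representations, at distance 0 of each other. *)
Inductive graph_point :=
| Vertex (v : V)
| EdgePoint (u v : V) (s : R) of adj u v & 0 <= s <= 1.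

Inductive edge_segment : graph_point -> graph_point -> R -> Prop :=
| edge_segment_same u v s s' uv uv' hs hs' :
    edge_segment (@EdgePoint u v s uv hs) (@EdgePoint u v s' uv' hs') `|s - s'|
| edge_segment_flip u v s s' uv vu hs hs' :
    edge_segment (@EdgePoint u v s uv hs) (@EdgePoint v u s' vu hs')
      `|s - (1 - s')|.

Inductive end_segment : graph_point -> V -> R -> Prop :=
| end_segment_vertex v : end_segment (Vertex v) v 0
| end_segment_left u v s uv hs : end_segment (@EdgePoint u v s uv hs) u s
| end_segment_right u v s uv hs : end_segment (@EdgePoint u v s uv hs) v (1 - s).

Definition path_lengths (p q : graph_point) : set R :=
  [set l | edge_segment p q l \/
     exists a b r r' n, [/\ end_segment p a r, end_segment q b r',
                            walk adj n a b & l = r + n%:R + r']].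

(* The path pseudometric for which edges have length one: a path from p to q
   either stays inside one edge or leaves p and reaches q through vertices. *)
Definition graph_dist (p q : graph_point) : R := inf (path_lengths p q).

End Realization.

Section Hyperbolicity.
Local Open Scope ring_scope.
Variables (R : realType) (X : Type) (d : X -> X -> R).

Definition gromov_product (w x y : X) : R := (d x w + d y w - d x y) / 2.

Definition gromov_hyperbolic : Prop :=
  exists delta : R, forall w x y z,
    Num.min (gromov_product w x y) (gromov_product w y z) - delta
      <= gromov_product w x z.

End Hyperbolicity.

(* Graphs are simplicial: adj is the adjacency relation. *)
Record cayley_abels_graph (G : topologicalGroupType) (V : Type)
    (adj : V -> V -> Prop) (act : G -> V -> V) : Prop := CayleyAbelsGraph {
  cag_sym : forall u v, adj u v -> adj v u;
  cag_irrefl : forall v, ~ adj v v;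
  cag_locally_finite : forall v, finite_set [set w | adj v w];
  cag_nonempty : exists v : V, True;
  cag_connected : forall u v, exists n, walk adj n u v;
  cag_act1 : forall v, act 1 v = v;
  cag_actM : forall g h v, act (g * h) v = act g (act h v);
  cag_act_adj : forall g u v, adj u v -> adj (act g u) (act g v);
  cag_transitive : forall u v, exists g, act g u = v;
  cag_stab_compact : forall v, compact [set g | act g v = v];
  cag_stab_open : forall v, open [set g | act g v = v] }.

Definition hyperbolic (R : realType) (G : topologicalGroupType) : Prop :=
  [/\ tdlc G, compactly_generated G
    & exists (V : Type) (adj : V -> V -> Prop) (act : G -> V -> V),
        cayley_abels_graph adj act /\ gromov_hyperbolic (@graph_dist R V adj)].

(* Main.v *)
(* Gromov's four-point condition for graph metrics is invariant under
   quasi-isometry (Morse lemma), and any two Cayley-Abels graphs of a group are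
   quasi-isometric, so it suffices to compare one graph of A with one of G.
   Take the coset graphs on A/C and G/C whose steps are C S C and
   C S C u (C t C)^{+-1}, where S generates A and contains alpha(C). Every edge
   gC of the Bass-Serre tree cuts G/C into two halves meeting only at the vertex
   gC. Hence A/C embeds isometrically in G/C, which gives one direction. For the
   other one, four points of G/C are reduced to a single coset of A: when an
   edge separates one point from the three others, that point is moved to the
   cut vertex, which changes the three sums of the four-point condition by the
   same amount; when an edge separates two points from the two others, the
   condition holds with constant 0. *)

From HB Require Import structures.
Require Import Defs.
From mathcomp Require Import all_boot all_order all_algebra.
From mathcomp Require Import all_classical all_reals all_analysis.
From mathcomp Require Import zify lra.

Set Implicit Arguments.
Unset Strict Implicit.
Unset Printing Implicit Defensive.

Import Order.TTheory GRing.Theory Num.Theory.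

Local Open Scope classical_set_scope.

(** * Quasi-isometry invariance of the four-point condition *)

Section GeodesicMetrics.
Local Open Scope nat_scope.

(** Exponential growth beats affine growth. This turns a bound on a distance by the logarithm of a
    multiple of itself into an absolute bound. *)
Lemma pow2_le_affine (a b : nat) :
  exists N, forall m, 2 ^ m <= a * m + b -> m <= N.
Proof.
have sq m : m.+1 ^ 2 <= 4 * 2 ^ m.
  elim: m => [|[|[|m]] IHm] //.
  by move: IHm; rewrite [2 ^ m.+3]expnS -!mulnn; nia.
by exists (4 * (a + b)) => m le2m; have := sq m; rewrite -mulnn; nia.
Qed.

Lemma pow2_between n : exists m, n <= 2 ^ m <= n.*2.+1.
Proof.
elim: n => [|n [m /andP[lenm lemn]]]; first by exists 0.
have [ltnm|gemn] := ltnP n (2 ^ m); first by exists m; lia.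
by exists m.+1; rewrite expnS; lia.
Qed.

(** Discrete connectedness; it finds a place on a path that is close to two sets covering the path,
    one from each end. *)
Lemma discrete_ivt (P Q : nat -> Prop) n :
  P 0 -> Q n -> (forall k, k <= n -> P k \/ Q k) ->
  exists k l, [/\ k <= l, l <= k.+1, l <= n, P k & Q l].
Proof.
move=> P0; elim: n => [|n IHn] Qn PQ; first by exists 0, 0.
have [Pn|/IHn[k le_kn|k [l [kl lk ln Pk Ql]]]] := PQ n (leqnSn n).
- by exists n, n.+1.
- exact/PQ/leqW.
- by exists k, l; split=> //; apply: leqW.
Qed.

Variable T : Type.
Implicit Types (d : T -> T -> nat) (x y z w p : T) (c : nat -> T).

Record geodesic_metric d : Prop := GeodesicMetric {
  geo_refl : forall x, d x x = 0;
  geo_sym : forall x y, d x y = d y x;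
  geo_triangle : forall x y z, d x z <= d x y + d y z;
  geo_interp : forall x y k, k <= d x y ->
    exists2 z, d x z = k & d z y = d x y - k }.

(** Gromov's condition without base point: of the three sums over opposite pairs, the two largest
    differ by at most [e]. *)
Definition four_point d e := forall x y z w,
  d x z + d y w <= maxn (d x y + d z w) (d y z + d x w) + e.

(* As d may vanish off the diagonal, a geodesic need not end exactly at y. *)
Definition geodesic_path d x y c : Prop :=
  [/\ c 0 = x,
      forall k, k <= d x y -> d (c k) y = d x y - k
    & forall k, k < d x y -> d (c k) (c k.+1) <= 1].

Lemma geodesic_path_exists d x y : geodesic_metric d ->
  exists c, geodesic_path d x y c.
Proof.
move=> gd; move dn: (d x y) => n; elim: n x dn => [|n IHn] x dn.
  by exists (fun=> x); split; rewrite ?dn.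
have [|z dxz dzy] := @geo_interp d gd x y 1; first by rewrite dn.
have [c [c0 cy c1]] := IHn z ltac:(lia).
exists (fun k => if k is l.+1 then c l else x); split=> // -[|k]; rewrite dn.
- by rewrite subn0.
- by move=> lekn; rewrite cy; lia.
- by rewrite c0 dxz.
- by move=> lekn; apply: c1; lia.
Qed.

Lemma geodesic_path_dist d x y c i j : geodesic_metric d ->
  geodesic_path d x y c -> i <= j -> j <= d x y -> d (c i) (c j) = j - i.
Proof.
move=> gd [c0 cy c1] leij lejn.
have le_steps k : i + k <= d x y -> d (c i) (c (i + k)) <= k.
  elim: k => [|k IHk] lekn; first by rewrite addn0 geo_refl.
  have := geo_triangle gd (c i) (c (i + k)) (c (i + k.+1)).
  by have := IHk ltac:(lia); have := c1 (i + k); rewrite addnS; lia.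
have := le_steps (j - i); rewrite subnKC // => /(_ lejn) ledij.
have := geo_triangle gd (c i) (c j) y.
by rewrite !cy; lia.
Qed.

(* Halving the path costs one use of the four-point condition, whence the
   logarithmic dependence of the bound on the length of the path. *)
Lemma four_point_path d e K c p : geodesic_metric d -> four_point d e ->
  forall m i j, i <= j -> j <= i + 2 ^ m ->
  (forall k, i <= k < j -> d (c k) (c k.+1) <= K) ->
  exists k, [/\ i <= k, k <= j & 2 * d p (c k) + d (c i) (c j) <=
    d (c i) p + d (c j) p + e * m + 2 * K].
Proof.
move=> gd fp; elim=> [|m IHm] i j leij leji cK.
  have ledK : d (c i) (c j) <= K.
    have [-> | ltij] : i = j \/ j = i.+1 by lia.
    - by rewrite geo_refl.
    - by rewrite ltij; apply: cK; lia.
  exists i; split=> //; have := geo_triangle gd (c i) (c j) p.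
  by rewrite (geo_sym gd p (c i)); lia.
pose h := minn j (i + 2 ^ m).
have leh : i <= h <= j by rewrite /h; lia.
have lehm : j <= h + 2 ^ m by rewrite /h; move: leji; rewrite expnS; lia.
have [|k1 [ik1 k1h b1]] := IHm i h ltac:(lia) ltac:(rewrite /h; lia).
  by move=> k lek; apply: cK; lia.
have [|k2 [ik2 k2h b2]] := IHm h j ltac:(lia) ltac:(lia).
  by move=> k lek; apply: cK; lia.
(* For one of the two halves, twice the Gromov product of the ends at [p] exceeds that of the whole
   path by at most [e]. *)
have := fp (c i) (c h) (c j) p; rewrite (geo_sym gd (c h)); move=> fph.
have [le1|le2] : d (c i) (c j) + d p (c h) <= d (c i) (c h) + d (c j) p + e \/
   d (c i) (c j) + d p (c h) <= d (c h) (c j) + d (c i) p + e by lia.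
- by exists k1; split; [lia|lia|]; rewrite (geo_sym gd (c h) p) in b1; nia.
- by exists k2; split; [lia|lia|]; rewrite (geo_sym gd (c h) p) in b2; nia.
Qed.

Variables d1 d2 : T -> T -> nat.
Hypotheses (gd1 : geodesic_metric d1) (gd2 : geodesic_metric d2).
Variables K e : nat.
Hypothesis le12 : forall x y, d1 x y <= K * d2 x y + K.
Hypothesis le21 : forall x y, d2 x y <= K * d1 x y + K.
Hypothesis fp1 : four_point d1 e.

(** First half of the Morse lemma. Around the point [p] of the interval farthest from the path, at
    distance [M], the path makes a detour of length linear in [M] that avoids the ball of radius
    [M]; [four_point_path] then bounds [M] by a logarithm of [M]. *)
Lemma geodesic_near_quasigeodesic : exists D, forall x y c,
  geodesic_path d2 x y c -> forall p, d1 x p + d1 p y <= d1 x y ->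
  exists2 k, k <= d2 x y & d1 p (c k) <= D.
Proof.
(* [N] bounds the number [m] of halvings below; the coefficients come from inserting the bound on
   [2 * M] into the one on [2 ^ m]. *)
have [N leN] := pow2_le_affine (6 * K * e)
  (6 * K * (2 * e + 6 * K) + 4 * K * K + 2 * K + 1).
exists (e * N + 2 * e + 6 * K) => x y c pc p0 p0I; set D := (_ + 6 * K).
pose far p r := forall k, k <= d2 x y -> r <= d1 p (c k).
(* The largest [r] with [E r] is the distance [M] to be bounded. *)
pose E r := `[< exists2 p, d1 x p + d1 p y <= d1 x y & far p r >].
have [c0 cy c1] := pc.
have exE : exists r, E r by exists 0; apply/asboolP; exists p0.
have ubE r : E r -> r <= d1 x y.
  move=> /asboolP [p pI /(_ 0 isT)]; rewrite c0 (geo_sym gd1 p x); lia.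
case: (ex_maxnP exE ubE) => M /asboolP [p pI farp] maxM.
have nearM q : d1 x q + d1 q y <= d1 x y ->
    exists2 k, k <= d2 x y & d1 q (c k) <= M.
  move=> qI; apply: contrapT => nq.
  suff : E M.+1 by move=> /maxM; rewrite ltnn.
  apply/asboolP; exists q => // k lek; rewrite ltnNge; apply/negP => leM.
  by apply: nq; exists k.
suff leMD : M <= D.
  by have [k lek lekM] := nearM p0 p0I; exists k => //; apply: leq_trans leMD.
have d1c k : k < d2 x y -> d1 (c k) (c k.+1) <= 2 * K.
  by move=> ltk; have := le12 (c k) (c k.+1); have := c1 k ltk; nia.
(* Points y' and z' at distance 2M from p on either side, or the endpoints. *)
have [y' [i [lei Iy' diy ley dpy]]] : exists y' i,
    [/\ i <= d2 x y, d1 x y' + d1 y' p = d1 x p,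
        d1 y' (c i) <= M + K, d1 y' p <= 2 * M
      & d1 y' (c i) + 2 * M <= d1 y' p + d1 p (c i) + 2 * K].
  have [le2M|gt2M] := leqP (d1 x p) (2 * M).
    exists x, 0; rewrite c0 geo_refl // leq0n.
    by have := farp 0 isT; rewrite c0 (geo_sym gd1 p x); split; lia.
  have [|y' dxy' dy'p] := @geo_interp _ gd1 x p (d1 x p - 2 * M); first by lia.
  have [|k lek dk] := nearM y'; first by have := geo_triangle gd1 y' p y; lia.
  by exists y', k; have := farp k lek; split; lia.
have [z' [j [lej Iz' djz lez dpz]]] : exists z' j,
    [/\ j <= d2 x y, d1 p z' + d1 z' y = d1 p y,
        d1 z' (c j) <= M + K, d1 z' p <= 2 * M
      & d1 z' (c j) + 2 * M <= d1 z' p + d1 p (c j) + 2 * K].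
  have [le2M|gt2M] := leqP (d1 p y) (2 * M).
    exists y, (d2 x y); rewrite (geo_refl gd1) leqnn.
    have d2y : d2 (c (d2 x y)) y = 0 by rewrite cy ?subnn.
    have := le12 (c (d2 x y)) y; rewrite d2y (geo_sym gd1 _ y) => dcy.
    have := farp (d2 x y) (leqnn _).
    have := geo_triangle gd1 p y (c (d2 x y)).
    by rewrite (geo_sym gd1 y p); split; lia.
  have [|z' dpz' dz'y] := @geo_interp _ gd1 p y (2 * M); first by lia.
  have [|k lek dk] := nearM z'; first by have := geo_triangle gd1 x p z'; lia.
  by exists z', k; rewrite (geo_sym gd1 z' p); have := farp k lek; split; lia.
have dyz : d1 y' p + d1 p z' <= d1 y' z'.
  have := geo_triangle gd1 x y' y; have := geo_triangle gd1 y' z' y; lia.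
have dcij : d1 (c i) (c j) <= 6 * M + 2 * K.
  have := geo_triangle gd1 (c i) y' (c j).
  have := geo_triangle gd1 y' z' (c j).
  have := geo_triangle gd1 y' p z'.
  by rewrite (geo_sym gd1 (c i) y') (geo_sym gd1 p z'); lia.
(* By [le21], the path has at most this many steps between [c i] and [c j]. *)
have [m /andP[leBm lemB]] := pow2_between (K * (6 * M + 2 * K) + K).
have [k lek bk] : exists2 k, k <= d2 x y &
    2 * d1 p (c k) + d1 (c i) (c j) <=
    d1 (c i) p + d1 (c j) p + e * m + 4 * K.
  wlog leij : i j lei lej dcij {diy dpy djz dpz} / i <= j => [hw|].
    have [leij|ltji] := leqP i j; first exact: hw.
    have [|k lek] := hw j i lej lei _ (ltnW ltji).
      by rewrite (geo_sym gd1).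
    by rewrite (geo_sym gd1 (c j)) => bk; exists k => //; lia.
  have dij := geodesic_path_dist gd2 pc leij lej.
  have := le21 (c i) (c j); rewrite dij => leji.
  have [|k' lek'|k [lik lkj bk]] :=
    @four_point_path _ _ (2 * K) c p gd1 fp1 m i j leij; first by nia.
    by apply: d1c; lia.
  by exists k; lia.
(* At [p], the Gromov product of [y'] and [z'] vanishes, those of [y'], [c i] and of [c j], [z'] are
   at least [M - K], and that of [c i], [c j] is bounded below by [bk]. Two uses of the four-point
   condition along this chain bound [M]. *)
have := farp k lek; have := fp1 y' (c i) z' p; have := fp1 (c i) (c j) z' p.
rewrite (geo_sym gd1 p z') in dyz; rewrite (geo_sym gd1 (c j) z').
rewrite (geo_sym gd1 p (c i)) in dpy; rewrite (geo_sym gd1 p (c j)) in dpz.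
move=> f1 f2 farM.
have le2M : 2 * M <= e * m + 2 * e + 6 * K by lia.
have /leN lemN : 2 ^ m <= 6 * K * e * m +
    (6 * K * (2 * e + 6 * K) + 4 * K * K + 2 * K + 1).
  by have := leq_mul (leqnn K) le2M; move: lemB; clear; nia.
have := leq_mul (leqnn e) lemN; rewrite /D; move: le2M; clear; lia.
Qed.

(** Second half of the Morse lemma. Each point of a [d1]-geodesic is near the path before or after
    [c k]; where this switches, an earlier and a later point of the path are close together, and
    [c k] lies on the short piece between them. *)
Lemma quasigeodesic_near_geodesic : exists D, forall x y c,
  geodesic_path d2 x y c -> forall k, k <= d2 x y ->
  exists2 p, d1 x p + d1 p y <= d1 x y & d1 (c k) p <= D.
Proof.
have [D nearD] := geodesic_near_quasigeodesic.
(* The summand [K] serves the endpoint: the last point of the path is only at [d2]-distance 0 from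
   [y], hence at [d1]-distance at most [K]. *)
pose E := K + D.
exists (K * (K * (2 * E + 1) + K) + K + E) => x y c pc k lek.
have [b pb] := geodesic_path_exists x y gd1.
have [c0 cy c1] := pc; have [b0 bY b1] := pb.
have bI l : l <= d1 x y -> d1 x (b l) + d1 (b l) y <= d1 x y.
  move=> lel; rewrite bY // -{1}b0 (geodesic_path_dist gd1 pb (leq0n l) lel).
  by lia.
have [||l lel|l [l' [ll' l'l l'n [i [ik di]] [j [kj jn dj]]]]] := @discrete_ivt
  (fun l => exists i, i <= k /\ d1 (b l) (c i) <= E)
  (fun l => exists j, [/\ k <= j, j <= d2 x y & d1 (b l) (c j) <= E]) (d1 x y).
- by exists 0; rewrite b0 c0 geo_refl.
- exists (d2 x y); split=> //.
  have := geo_triangle gd1 (b (d1 x y)) y (c (d2 x y)).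
  rewrite bY // subnn (geo_sym gd1 y).
  have := le12 (c (d2 x y)) y; rewrite cy // subnn /E; lia.
- have [i lei di] := nearD _ _ _ pc _ (bI l lel).
  have [leik|/ltnW ltki] := leqP i k; [left|right].
    by exists i; rewrite /E; split; lia.
  by exists i; rewrite /E; split; lia.
have lel : l <= d1 x y by lia.
exists (b l); first exact: bI.
have dll' : d1 (b l) (b l') <= 1.
  by rewrite (geodesic_path_dist gd1 pb) //; lia.
have dij : d1 (c i) (c j) <= 2 * E + 1.
  have := geo_triangle gd1 (c i) (b l) (c j).
  have := geo_triangle gd1 (b l) (b l') (c j).
  by rewrite (geo_sym gd1 (c i) (b l)); lia.
have leki : d2 (c i) (c k) <= K * (2 * E + 1) + K.
  have := le21 (c i) (c j); have := leq_mul (leqnn K) dij.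
  by rewrite !(geodesic_path_dist gd2 pc) //; lia.
have := le12 (c i) (c k); have := leq_mul (leqnn K) leki.
have := geo_triangle gd1 (c k) (c i) (b l).
by rewrite (geo_sym gd1 (c i) (b l)) (geo_sym gd1 (c k) (c i)); lia.
Qed.

(** Thin triangles for [d2]: [c k] is near a point [p] of a [d1]-geodesic, the four-point condition
    puts [p] near one of the other two sides, and the Morse lemma brings this back to [d2]. *)
Lemma quasigeodesic_thin : exists D, forall x y c,
  geodesic_path d2 x y c -> forall k z, k <= d2 x y ->
  d2 x (c k) + d2 (c k) z <= d2 x z + D \/
  d2 z (c k) + d2 (c k) y <= d2 z y + D.
Proof.
have [D1 near1] := geodesic_near_quasigeodesic.
have [D2 near2] := quasigeodesic_near_geodesic.
exists (2 * (K * (D2 + 2 * e + D1) + K)) => x y c pc k z lek.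
have [p pI dp] := near2 _ _ _ pc k lek.
have thin1 u v : d1 u p + d1 p v <= d1 u v + e ->
    d2 u (c k) + d2 (c k) v <= d2 u v + 2 * (K * (D2 + 2 * e + D1) + K).
  move=> uvp.
  (* The Morse lemma needs a point exactly in the interval, so [p] is replaced by such a point [q]
     nearby. *)
  have [q qI dpq] : exists2 q, d1 u q + d1 q v <= d1 u v & d1 p q <= 2 * e.
    have [le_up|lt_vp] := leqP (d1 u p) (d1 u v).
      have [q duq dqv] := @geo_interp _ gd1 u v (d1 u p) le_up.
      exists q; first by lia.
      by have := fp1 p u q v; rewrite (geo_sym gd1 p u); lia.
    by exists v; rewrite ?(geo_refl gd1); lia.
  have [b pb] := geodesic_path_exists u v gd2.
  have [l lel dl] := near1 _ _ _ pb _ qI.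
  have [b0 bv b1] := pb.
  have dub := geodesic_path_dist gd2 pb (leq0n l) lel; rewrite b0 in dub.
  have dbv := bv l lel.
  have dcb : d1 (c k) (b l) <= D2 + 2 * e + D1.
    have := geo_triangle gd1 (c k) p (b l); have := geo_triangle gd1 p q (b l).
    by lia.
  have := le21 (c k) (b l); have := leq_mul (leqnn K) dcb.
  have := geo_triangle gd2 u (b l) (c k).
  have := geo_triangle gd2 (c k) (b l) v.
  by rewrite (geo_sym gd2 (b l) (c k)); lia.
have := fp1 x z y p.
rewrite (geo_sym gd1 z p) (geo_sym gd1 y p) => fpz.
have [le_xz|le_zy] : d1 x p + d1 p z <= d1 x z + e \/
  d1 z p + d1 p y <= d1 z y + e by rewrite (geo_sym gd1 z p); lia.
- by left; apply: thin1.
- by right; apply: thin1.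
Qed.

(** By thinness and connectedness, some [c k] on a geodesic from [x] to [z] is almost on both other
    sides of the triangle with [w]. It is also almost between [y] and one of [x], [z], and adding
    these estimates gives the condition. *)
Theorem four_point_quasi_isometry : exists e', four_point d2 e'.
Proof.
have [D thinD] := quasigeodesic_thin.
exists (2 * D + 2) => x y z w.
have [c pc] := geodesic_path_exists x z gd2; have [c0 cz c1] := pc.
have [||k lek|k [l [lekl lelk lel Pk Ql]]] := @discrete_ivt
  (fun k => d2 x (c k) + d2 (c k) w <= d2 x w + D)
  (fun k => d2 w (c k) + d2 (c k) z <= d2 w z + D) (d2 x z).
- by rewrite c0 geo_refl // add0n leq_addr.
- by rewrite cz // subnn addn0 -(leq_add2r (d2 (c (d2 x z)) z));
    have := geo_triangle gd2 w z (c (d2 x z));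
    rewrite (geo_sym gd2 z) cz // subnn; lia.
- exact: thinD.
have dkl : d2 (c k) (c l) <= 1.
  by rewrite (geodesic_path_dist gd2 pc) //; lia.
have lek : k <= d2 x z by lia.
have dxk := geodesic_path_dist gd2 pc (leq0n k) lek; rewrite c0 in dxk.
have dkz := cz k lek.
have Qk : d2 w (c k) + d2 (c k) z <= d2 w z + D + 2.
  have := geo_triangle gd2 w (c l) (c k).
  have := geo_triangle gd2 (c k) (c l) z.
  by rewrite (geo_sym gd2 (c l) (c k)); lia.
have := geo_triangle gd2 y (c k) w; rewrite (geo_sym gd2 (c k) w).
rewrite (geo_sym gd2 (c k) w) in Pk.
have [] := thinD _ _ _ pc k y lek;
  rewrite (geo_sym gd2 z w) ?(geo_sym gd2 (c k) y); lia.
Qed.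

End GeodesicMetrics.

(** * The geometric realization of a graph *)

Section WalkDistance.
Local Open Scope nat_scope.
Variables (V : Type) (adj : V -> V -> Prop).
Hypothesis adj_sym : forall u v, adj u v -> adj v u.
Hypothesis adj_connected : forall u v, exists n, walk adj n u v.

(** The default 0 is never reached when the graph is connected. *)
Definition walk_dist (u v : V) : nat :=
  xget 0 [set n | walk adj n u v /\ forall m, walk adj m u v -> n <= m].

Lemma walk_distP u v :
  walk adj (walk_dist u v) u v /\
  forall m, walk adj m u v -> walk_dist u v <= m.
Proof.
rewrite /walk_dist; case: xgetP => [n -> //|none]; exfalso.
have exW : exists n, `[< walk adj n u v >].
  by have [n wn] := adj_connected u v; exists n; apply/asboolP.
case: (ex_minnP exW) => n /asboolP wn min_n; apply: (none n); split=> // m wm.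
exact/min_n/asboolP.
Qed.

Lemma walk_dist_le n u v : walk adj n u v -> walk_dist u v <= n.
Proof. exact: (walk_distP u v).2. Qed.

Lemma walk_cat m n u v w :
  walk adj m u v -> walk adj n v w -> walk adj (m + n) u w.
Proof.
elim: m u => [|m IHm] u /=; first by move=> ->.
by case=> u' uu' wm wn; exists u' => //; apply: IHm.
Qed.

Lemma walk_rev n u v : walk adj n u v -> walk adj n v u.
Proof.
elim: n u => [|n IHn] u /=; first by move=> ->.
case=> u' uu' /IHn wn; suff : walk adj (n + 1) v u by rewrite addn1.
by apply: (walk_cat wn); exists u => //; apply: adj_sym.
Qed.

Lemma walk_split m n u w :
  walk adj (m + n) u w -> exists2 v, walk adj m u v & walk adj n v w.
Proof.
elim: m u => [|m IHm] u /=; first by exists u.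
by case=> u' uu' /IHm[v wm wn]; exists v => //; exists u'.
Qed.

Lemma walk_dist_geodesic : geodesic_metric walk_dist.
Proof.
split.
- by move=> x; apply/eqP; rewrite -leqn0; apply: walk_dist_le.
- by move=> x y; apply/eqP; rewrite eqn_leq; apply/andP; split;
    apply/walk_dist_le/walk_rev; apply: (walk_distP _ _).1.
- move=> x y z; apply: walk_dist_le.
  exact: walk_cat (walk_distP x y).1 (walk_distP y z).1.
- move=> x y k lek; have := (walk_distP x y).1; rewrite -{1}(subnKC lek).
  case/walk_split=> z wk wl; exists z; have := walk_dist_le wk;
    have := walk_dist_le wl; have := (walk_distP x y).2 _
      (walk_cat (walk_distP x z).1 (walk_distP z y).1); lia.
Qed.

Lemma walk_dist_eq0 u v : walk_dist u v = 0 -> u = v.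
Proof. by move=> d0; have := (walk_distP u v).1; rewrite d0. Qed.

Lemma walk_dist_le1 u v : walk_dist u v <= 1 -> u = v \/ adj u v.
Proof.
have := (walk_distP u v).1; case: walk_dist => [|[|//]] /=; first by left.
by case=> w uw <-; right.
Qed.

Lemma walk_dist_adj u v : adj u v -> walk_dist u v <= 1.
Proof. by move=> uv; apply: walk_dist_le; exists v. Qed.

End WalkDistance.

(** * Comparison of the realization with its vertex set *)

Section Realization.
Local Open Scope ring_scope.
Variables (R : realType).

(** Each Gromov product moves by at most [3k/2], once on either side of the inequality. *)
Lemma gromov_hyperbolic_four_point (X : Type) (d : X -> X -> R) (V : Type)
    (f : X -> V) (D : V -> V -> nat) (k : nat) (e : nat) :
  (forall p q, `|d p q - (D (f p) (f q))%:R| <= k%:R) ->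
  four_point D e -> (forall x y, D x y = D y x) -> gromov_hyperbolic d.
Proof.
move=> dD fp Dsym; exists (e%:R + 3 * k%:R) => w x y z.
rewrite /gromov_product.
have := dD x w; have := dD y w; have := dD z w.
have := dD x y; have := dD y z; have := dD x z.
rewrite !ler_norml => /andP[a1 a2] /andP[b1 b2] /andP[c1 c2].
move=> /andP[a3 a4] /andP[b3 b4] /andP[c3 c4].
have k0 := ler0n R k; have e0 := ler0n R e.
have := fp (f x) (f y) (f z) (f w).
have [le|lt] := leqP (D (f x) (f y) + D (f z) (f w))%N
    (D (f y) (f z) + D (f x) (f w))%N;
  rewrite ?(maxn_idPr le) ?(maxn_idPl (ltnW lt)).
- rewrite -(ler_nat R) !natrD => H.
  rewrite lerBlDr ge_min; apply/orP; right; lra.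
- rewrite -(ler_nat R) !natrD => H.
  rewrite lerBlDr ge_min; apply/orP; left; lra.
Qed.

Variables (V : Type) (adj : V -> V -> Prop).
Hypothesis adj_sym : forall u v, adj u v -> adj v u.
Hypothesis adj_connected : forall u v, exists n, walk adj n u v.
Let gD := walk_dist_geodesic adj_sym adj_connected.

Lemma path_lengths_ge0 (p q : graph_point R adj) : lbound (path_lengths p q) 0.
Proof.
move=> l [[]|[a [b [r [r' [n [pa qb _ ->]]]]]]] //.
have end_ge0 (p' : graph_point R adj) v s : end_segment p' v s -> 0 <= s.
  by case=> // ????; [move=> /andP[]|move=> /andP[_]; rewrite subr_ge0].
by rewrite !addr_ge0 ?(end_ge0 _ _ _ pa) ?(end_ge0 _ _ _ qb).
Qed.

Lemma end_segment_Vertex (v a : V) (r : R) :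
  end_segment (Vertex R adj v) a r -> a = v /\ r = 0.
Proof. by move pE: (Vertex R adj v) => p pa; case: pa pE => // w [->]. Qed.

Lemma path_lengths_Vertex u v l :
  path_lengths (Vertex R adj u) (Vertex R adj v) l <->
  exists2 n, walk adj n u v & l = n%:R.
Proof.
split=> [[|[a [b [r [r' [n [pa qb wn ->]]]]]]]|[n wn ->]].
- by move pE: (Vertex R adj u) => p es; case: es pE.
- have [<- ->] := end_segment_Vertex pa; have [<- ->] := end_segment_Vertex qb.
  by exists n; rewrite ?addr0 ?add0r.
- right; exists u, v, 0, 0, n; rewrite add0r addr0.
  by split=> //; constructor.
Qed.

Lemma graph_dist_Vertex u v :
  graph_dist (Vertex R adj u) (Vertex R adj v) = (walk_dist adj u v)%:R.
Proof.
have [wuv min_w] := walk_distP adj_connected u v.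
have Ld : path_lengths (Vertex R adj u) (Vertex R adj v) (walk_dist adj u v)%:R.
  by apply/path_lengths_Vertex; exists (walk_dist adj u v).
apply/eqP; rewrite eq_le; apply/andP; split.
  by apply: ge_inf => //; exists 0; apply: path_lengths_ge0.
apply: lb_le_inf; first by exists (walk_dist adj u v)%:R.
by move=> l /path_lengths_Vertex[n wn ->]; rewrite ler_nat min_w.
Qed.

(** A map to the vertices that moves every point by at most 1. *)
Definition base_vertex (p : graph_point R adj) : V :=
  match p with Vertex v => v | EdgePoint u _ _ _ _ => u end.

Lemma end_segment_base p a r : end_segment p a r ->
  0 <= r <= 1 /\ (walk_dist adj (base_vertex p) a <= 1)%N.
Proof.
case=> [v|u v s uv hs|u v s uv hs]; rewrite /= ?(geo_refl gD).
- by rewrite lexx ler01.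
- by rewrite hs.
- split; last exact: walk_dist_adj.
  by case/andP: hs => s0 s1; rewrite subr_ge0 s1 gerBl.
Qed.

Lemma base_segment p : exists2 r : R, r <= 1 & end_segment p (base_vertex p) r.
Proof.
case: p => [v|u v s uv hs]; first by exists 0 => //; constructor.
by exists s; [case/andP: hs|constructor].
Qed.

Lemma graph_dist_base p q :
  `|graph_dist p q - (walk_dist adj (base_vertex p) (base_vertex q))%:R|
    <= 2%:R.
Proof.
have [wpq min_w] := walk_distP adj_connected (base_vertex p) (base_vertex q).
set n := walk_dist _ _ _ in wpq min_w *.
have [r r1 pr] := base_segment p; have [r' r'1 qr'] := base_segment q.
have Ln : path_lengths p q (r + n%:R + r').
  by right; exists (base_vertex p), (base_vertex q), r, r', n.
rewrite ler_distl; apply/andP; split.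
  apply: lb_le_inf; first by exists (r + n%:R + r').
  move=> l [|[a [b [s [s' [m [pa qb wm ->]]]]]]].
    rewrite /n; case=> [u v s s' uv uv' hs hs'|u v s s' uv vu hs hs'] /=.
      by rewrite (geo_refl gD) sub0r (@le_trans _ _ 0) ?oppr_le0.
    apply: (@le_trans _ _ 0) => //; rewrite subr_le0 ler_nat.
    by apply: leq_trans (walk_dist_adj adj_connected uv) _.
  have [/andP[s0 _] pad] := end_segment_base pa.
  have [/andP[s'0 _] qbd] := end_segment_base qb.
  have : (n <= m + 2)%N.
    have := walk_dist_le adj_connected wm.
    have := geo_triangle gD (base_vertex p) a (base_vertex q).
    have := geo_triangle gD a b (base_vertex q).
    by rewrite (geo_sym gD b) /n; lia.
  by rewrite -(ler_nat R) natrD; lra.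
rewrite -/(graph_dist p q); apply: (@le_trans _ _ (r + n%:R + r')); last by lra.
by apply: ge_inf => //; exists 0; apply: path_lengths_ge0.
Qed.

Lemma gromov_hyperbolic_graph :
  gromov_hyperbolic (@graph_dist R V adj) <->
  exists e, four_point (walk_dist adj) e.
Proof.
split=> [[delta hyp]|[e fp]]; last first.
  exact: gromov_hyperbolic_four_point graph_dist_base fp (geo_sym gD).
(* Gromov products carry a factor 1/2, which doubles [delta]. *)
have [e le_e] : exists e : nat, 2 * delta <= e%:R.
  exists (Num.bound `|2 * delta|).
  by apply: (le_trans (ler_norm _)); apply/ltW/archi_boundP.
exists e => x y z w; rewrite leqNgt; apply/negP.
have := hyp (Vertex R adj w) (Vertex R adj x) (Vertex R adj y) (Vertex R adj z).
rewrite /gromov_product !graph_dist_Vertex lerBlDr ge_min.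
case/orP=> H; rewrite -(ltr_nat R) !natrD.
- have := leq_maxl (walk_dist adj x y + walk_dist adj z w)
    (walk_dist adj y z + walk_dist adj x w).
  by rewrite -(ler_nat R) !natrD; lra.
- have := leq_maxr (walk_dist adj x y + walk_dist adj z w)
    (walk_dist adj y z + walk_dist adj x w).
  by rewrite -(ler_nat R) !natrD; lra.
Qed.
End Realization.

(** * Cayley-Abels graphs *)

Section TopologicalGroups.
Local Open Scope group_scope.
Variable G : topologicalGroupType.
Implicit Types (g h : G) (C K : set G).

Lemma continuous_mulg (T : topologicalType) (f1 f2 : T -> G) :
  continuous f1 -> continuous f2 -> continuous (fun x => f1 x * f2 x).
Proof.
move=> c1 c2 x.
exact: (cvg_comp _ _ (cvg_pair (c1 x) (c2 x))
  (@mulg_continuous G (f1 x, f2 x))).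
Qed.

Lemma continuous_lmulg g : continuous (fun x : G => g * x).
Proof. by apply: continuous_mulg => x; [apply: cvg_cst|apply: cvg_id]. Qed.

Lemma continuous_rmulg g : continuous (fun x : G => x * g).
Proof. by apply: continuous_mulg => x; [apply: cvg_id|apply: cvg_cst]. Qed.

Lemma open_preimage (T U : topologicalType) (f : T -> U) (B : set U) :
  continuous f -> open B -> open (f @^-1` B).
Proof. by move=> /continuousP; apply. Qed.

Lemma open_lcoset C g : open C -> open [set x | C (g^-1 * x)].
Proof. exact/open_preimage/continuous_lmulg. Qed.

(* The library states the covering property for pointed spaces. *)
Lemma compact_coverE : @compact G = @cover_compact G.
Proof.
pose pG : ptopologicalType :=
  HB.pack (TopologicalGroup.sort G)
    (isPointed.Build (TopologicalGroup.sort G) 1).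
exact: (@compact_cover pG).
Qed.

Lemma compact_mulg (K L : set G) : compact K -> compact L ->
  compact [set x | exists y z, [/\ K y, L z & x = y * z]].
Proof.
move=> cK cL; have := continuous_compact
  (continuous_subspaceT (@mulg_continuous G)) (compact_setX cK cL).
congr compact; apply/seteqP; split=> x /=.
  by case=> -[y z] [/= Ky Lz] <-; exists y, z.
by case=> y [z [Ky Lz ->]]; exists (y, z).
Qed.

Lemma compact_invg K : compact K -> compact [set x^-1 | x in K].
Proof. exact/continuous_compact/continuous_subspaceT/invg_continuous. Qed.

Lemma compact_finite_lcosets C K : open C -> C 1 -> compact K ->
  exists2 F : seq G, {subset F <= K} &
    forall x, K x -> exists2 g, g \in F & C (g^-1 * x).
Proof.
move=> oC C1; rewrite compact_coverE => cK.
have [|x Kx|F FK KF] := cK G K (fun g => [set x | C (g^-1 * x)]).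
- by move=> g _; apply: open_lcoset.
- by exists x => //=; rewrite mulVg.
- exists (finmap.enum_fset F) => [g /FK //|x /KF[g gF Cgx]].
  by exists g.
Qed.

End TopologicalGroups.

(** * Orbit metrics of Cayley-Abels graphs *)

Section CayleyAbels.

Local Open Scope group_scope.
Variables (G : topologicalGroupType) (V : Type).
Variables (adj : V -> V -> Prop) (act : G -> V -> V).
Hypothesis cag : cayley_abels_graph adj act.

Lemma cag_walk_act g n u v : walk adj n u v -> walk adj n (act g u) (act g v).
Proof.
elim: n u => [|n IHn] u /=; first by move=> ->.
by case=> w uw /IHn wn; exists (act g w) => //; apply: cag_act_adj cag _ _ _ uw.
Qed.

Lemma cag_actK g v : act g^-1 (act g v) = v.
Proof. by rewrite -(cag_actM cag) mulVg (cag_act1 cag). Qed.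

Lemma cag_dist_act g u v :
  walk_dist adj (act g u) (act g v) = walk_dist adj u v.
Proof.
have conn := cag_connected cag.
suff le k x y : (walk_dist adj (act k x) (act k y) <= walk_dist adj x y)%N.
  apply/eqP; rewrite eqn_leq le /=.
  by have := le g^-1 (act g u) (act g v); rewrite !cag_actK.
exact/(walk_dist_le conn)/cag_walk_act/(walk_distP conn x y).1.
Qed.

Variable v : V.

(** Pulling back along the orbit map puts the metrics of all Cayley-Abels graphs on the same set
    [G]. *)
Definition cag_dist (g h : G) : nat := walk_dist adj (act g v) (act h v).

Lemma cag_dist_mulg k g h : cag_dist (k * g) (k * h) = cag_dist g h.
Proof. by rewrite /cag_dist !(cag_actM cag) cag_dist_act. Qed.

Lemma cag_distE g h : cag_dist g h = cag_dist 1 (g^-1 * h).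
Proof. by rewrite -[RHS](cag_dist_mulg g) mulg1 mulVKg. Qed.

Lemma cag_dist_geodesic : geodesic_metric cag_dist.
Proof.
have gd := walk_dist_geodesic (cag_sym cag) (cag_connected cag).
split=> [g|g h|g h k|g h k].
- exact: geo_refl gd _.
- exact: geo_sym gd _ _.
- exact: geo_triangle gd _ _ _.
- move/(geo_interp gd) => [w d1 d2].
  have [x xw] := cag_transitive cag v w.
  by exists x; rewrite /cag_dist xw.
Qed.

Lemma four_point_cag_dist e :
  four_point cag_dist e <-> four_point (walk_dist adj) e.
Proof.
split=> fp; last by move=> g h k l; apply: fp.
move=> x y z w.
have [gx <-] := cag_transitive cag v x; have [gy <-] := cag_transitive cag v y.
have [gz <-] := cag_transitive cag v z; have [gw <-] := cag_transitive cag v w.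
exact: fp.
Qed.

(** [K] meets finitely many cosets of the open stabilizer of [v], and the distance from 1 is
    constant on each. *)
Lemma cag_dist_compact K : compact K ->
  exists n, forall g, K g -> (cag_dist 1%g g <= n)%N.
Proof.
have gd := cag_dist_geodesic.
move=> /(compact_finite_lcosets (cag_stab_open cag v) (cag_act1 cag v)).
case=> F _ FK; exists (\max_(g <- F) cag_dist 1%g g) => g /FK[h hF /= sth].
have dhg : cag_dist h g = 0%N.
  rewrite cag_distE /cag_dist sth -[X in walk_dist _ _ X](cag_act1 cag).
  exact: geo_refl gd _.
have := geo_triangle gd 1 h g; rewrite dhg addn0 => /leq_trans; apply.
by rewrite (big_rem h) //= leq_maxl.
Qed.

End CayleyAbels.

(** * Comparison of two Cayley-Abels graphs of a group *)

Section CayleyAbelsUniqueness.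
Local Open Scope group_scope.
Variables (G : topologicalGroupType).
Variables (V : Type) (adj : V -> V -> Prop) (act : G -> V -> V).
Variables (V' : Type) (adj' : V' -> V' -> Prop) (act' : G -> V' -> V').
Hypothesis cag : cayley_abels_graph adj act.
Hypothesis cag' : cayley_abels_graph adj' act'.
Variables (v : V) (v' : V').

(** Finitely many elements [f w] reach [v] and its neighbours, and any other element doing so
    differs from them by the compact stabilizer; hence one step has bounded length in the second
    graph. The additive [K] covers distinct elements at distance 0. *)
Lemma cag_dist_lipschitz : exists K, forall g h,
  (cag_dist adj' act' v' g h <= K * cag_dist adj act v g h + K)%N.
Proof.
have gd := cag_dist_geodesic cag v; have gd' := cag_dist_geodesic cag' v'.
have fN : finite_set ([set v] `|` [set w | adj v w]).
  rewrite finite_setU; split; first exact: finite_set1.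
  exact: cag_locally_finite cag v.
have /choice[f fE] w : exists g, act g v = w by apply: cag_transitive cag v w.
have /finite_seqP[s sE] := finite_image f fN.
have [n nE] := cag_dist_compact cag' v' (@cag_stab_compact _ _ _ _ cag v).
pose K := (\max_(g <- s) cag_dist adj' act' v' 1%g g + n)%N.
have K1 g h : (cag_dist adj act v g h <= 1)%N ->
    (cag_dist adj' act' v' g h <= K)%N.
  move=> /(walk_dist_le1 (cag_connected cag)) vgh.
  rewrite (cag_distE cag'); set k := g^-1 * h.
  have vk : v = act k v \/ adj v (act k v).
    rewrite /k (cag_actM cag).
    case: vgh => [<-|/(cag_act_adj cag g^-1)]; rewrite (cag_actK cag);
      by [left|right].
  have sfk : f (act k v) \in s.
    suff : [set` s] (f (act k v)) by [].
    by rewrite -sE; exists (act k v) => //; case: vk; [left|right].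
  have := geo_triangle gd' 1 (f (act k v)) k.
  rewrite [X in (_ <= _ + X)%N](cag_distE cag') => /leq_trans; apply.
  rewrite leq_add ?(big_rem _ sfk) ?leq_maxl //=; apply: nE => /=.
  by rewrite (cag_actM cag) -{2}(fE (act k v)) (cag_actK cag).
exists K => g h; move dn: (cag_dist adj act v g h) => m.
elim: m g dn => [|m IHm] g dn; first by rewrite muln0 K1 ?dn.
have [|k dgk dkh] := @geo_interp _ _ gd g h 1; first by rewrite dn.
have := geo_triangle gd' g k h; have := IHm k; have := K1 g k.
by rewrite dgk dkh dn subn1 /= => /(_ (leqnn 1)) ? /(_ erefl); nia.
Qed.

End CayleyAbelsUniqueness.

Lemma cag_four_point (G : topologicalGroupType)
    (V : Type) (adj : V -> V -> Prop) (act : G -> V -> V)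
    (V' : Type) (adj' : V' -> V' -> Prop) (act' : G -> V' -> V') :
  cayley_abels_graph adj act -> cayley_abels_graph adj' act' ->
  (exists e, four_point (walk_dist adj) e) ->
  exists e, four_point (walk_dist adj') e.
Proof.
move=> cag cag' [e].
have [[v _] [v' _]] := (cag_nonempty cag, cag_nonempty cag').
move=> /(four_point_cag_dist cag v) fp.
have [K1 le1] := cag_dist_lipschitz cag cag' v v'.
have [K2 le2] := cag_dist_lipschitz cag' cag v' v.
have [||e' fp'] := four_point_quasi_isometry (K := maxn K1 K2)
  (cag_dist_geodesic cag v) (cag_dist_geodesic cag' v') _ _ fp.
- move=> g h; apply: leq_trans (le2 g h) _.
  by rewrite leq_add ?leq_mul ?leq_maxr.
- move=> g h; apply: leq_trans (le1 g h) _.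
  by rewrite leq_add ?leq_mul ?leq_maxl.
- by exists e'; apply/(four_point_cag_dist cag' v').
Qed.

(** * Coset graphs *)

Section Subgroups.
Local Open Scope group_scope.
Variables (G : groupType) (C : set G).
Hypothesis sC : subgroup C.

Lemma subgroup1 : C 1. Proof. by case: sC. Qed.

Lemma subgroupM x y : C x -> C y -> C (x * y).
Proof. by case: sC => _ + _; apply. Qed.

Lemma subgroupV x : C x -> C x^-1.
Proof. by case: sC => _ _; apply. Qed.

Lemma subgroupMl x y : C x -> C (x * y) <-> C y.
Proof.
move=> Cx; split=> [Cxy|]; last exact: subgroupM.
by rewrite -(mulKg x y); apply: subgroupM => //; apply: subgroupV.
Qed.

Lemma subgroupMr x y : C y -> C (x * y) <-> C x.
Proof.
move=> Cy; split=> [Cxy|Cx]; last exact: subgroupM.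
by rewrite -(mulgK y x); apply: subgroupM => //; apply: subgroupV.
Qed.

Lemma subgroup_divC x y : C (x^-1 * y) -> C (y^-1 * x).
Proof. by move=> /subgroupV; rewrite invgM invgK. Qed.

End Subgroups.

Section CosetGraph.
Local Open Scope group_scope.
Variables (G : topologicalGroupType) (C S : set G).
Hypothesis sC : subgroup C.

Definition coset_space := {A : set G | exists g, A = [set x | C (g^-1 * x)]}.

Definition coset_of (g : G) : coset_space :=
  exist _ [set x | C (g^-1 * x)] (ex_intro _ g erefl).

Definition coset_act (g : G) (A : coset_space) : coset_space.
Proof.
exists [set x | sval A (g^-1 * x)].
abstract (case: A => A /= [h ->]; exists (g * h);
  by apply/seteqP; split=> x /=; rewrite invgM mulgA).
Defined.

(* The elements moving the base vertex C to itself or to a neighbour. *)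
Definition coset_steps : set G := [set g | exists c s c',
  [/\ C c, C c', [\/ S s, S s^-1 | s = 1] & g = c * s * c']].

(** The steps include [C] itself, so loops are excluded by hand. *)
Definition coset_adj (A B : coset_space) : Prop :=
  A <> B /\ exists g h, [/\ sval A g, sval B h & coset_steps (g^-1 * h)].

Lemma coset_of_eqP g h : coset_of g = coset_of h <-> C (g^-1 * h).
Proof.
split=> [/(congr1 sval)/= /(congr1 (fun A : set G => A h))/= ->|Cgh].
  by rewrite mulVg; apply: subgroup1.
apply: eq_exist; apply/seteqP; split=> x /= Cx.
- have := subgroupM sC (subgroup_divC sC Cgh) Cx.
  by rewrite mulgA mulgK.
- have := subgroupM sC Cgh Cx.
  by rewrite mulgA mulgK.
Qed.

Lemma sval_coset_of (A : coset_space) g : sval A g <-> A = coset_of g.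
Proof.
split=> [|->]; last by rewrite /= mulVg; apply: subgroup1.
case: A => A [h Ah] /= Ag; have Chg : C (h^-1 * g) by move: Ag; rewrite Ah.
transitivity (coset_of h); first exact: eq_exist.
exact/coset_of_eqP.
Qed.

Lemma coset_of_surj A : exists g, A = coset_of g.
Proof.
case: A => A [g Ag]; exists g; exact: eq_exist.
Qed.

Lemma coset_act_of g h : coset_act g (coset_of h) = coset_of (g * h).
Proof.
by apply/sval_coset_of => /=; rewrite mulKg mulVg; apply: subgroup1.
Qed.

(** The steps are a union of double cosets, so adjacency does not depend on representatives. *)
Lemma coset_stepsM c g c' : C c -> C c' ->
  coset_steps (c * g * c') <-> coset_steps g.
Proof.
have stM k k' h : C k -> C k' -> coset_steps h -> coset_steps (k * h * k').
  move=> Ck Ck' [c1 [s [c2 [C1 C2 Ss ->]]]].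
  exists (k * c1), s, (c2 * k'); split=> //; first exact: subgroupM.
    exact: subgroupM.
  by rewrite !mulgA.
move=> Cc Cc'; split=> [st|]; last exact: stM.
have := stM _ _ _ (subgroupV sC Cc) (subgroupV sC Cc') st.
by rewrite !mulgA mulVg mul1g mulgK.
Qed.

Lemma coset_stepsV g : coset_steps g -> coset_steps g^-1.
Proof.
case=> c [s [c' [Cc Cc' Ss ->]]]; exists c'^-1, s^-1, c^-1; split.
- exact: subgroupV.
- exact: subgroupV.
- rewrite invgK; case: Ss => [Ss|Ss|->]; [exact: Or32|exact: Or31|].
  by apply: Or33; rewrite invg1.
- by rewrite !invgM mulgA.
Qed.

Lemma coset_steps_subgroup c : C c -> coset_steps c.
Proof.
move=> Cc; exists c, 1, 1; split=> //; first exact: subgroup1.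
  exact: Or33.
by rewrite !mulg1.
Qed.

Lemma coset_adj_of g h :
  coset_adj (coset_of g) (coset_of h) <->
  ~ C (g^-1 * h) /\ coset_steps (g^-1 * h).
Proof.
split=> [[ngh [g' [h' [/= Cg Ch st]]]]|[nC st]].
  split; first by move=> /coset_of_eqP.
  have -> : g^-1 * h = (g^-1 * g') * (g'^-1 * h') * (h'^-1 * h).
    by rewrite !mulgA !mulgK.
  by apply/coset_stepsM => //; apply: subgroup_divC.
split; first by move=> /coset_of_eqP.
by exists g, h; split=> //=; rewrite mulVg; apply: subgroup1.
Qed.

Lemma coset_adj_sym A B : coset_adj A B -> coset_adj B A.
Proof.
move=> [nAB [g [h [Ag Bh /coset_stepsV st]]]]; split; first by move=> /esym.
by exists h, g; split=> //; move: st; rewrite invgM invgK.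
Qed.

Lemma coset_act_adj g A B :
  coset_adj A B -> coset_adj (coset_act g A) (coset_act g B).
Proof.
have [h ->] := coset_of_surj A; have [k ->] := coset_of_surj B.
by rewrite !coset_act_of !coset_adj_of invgM -mulgA mulKg.
Qed.

Hypotheses (oC : open C) (cC : compact C) (cS : compact S).
Hypothesis gen : forall M, subgroup M -> C `<=` M -> S `<=` M -> M = setT.

Lemma coset_steps_compact : compact coset_steps.
Proof.
have cS' : compact (S `|` [set x^-1 | x in S] `|` [set 1]).
  apply: compactU; last exact: compact_set1.
  by apply: compactU => //; apply: compact_invg.
have := compact_mulg (compact_mulg cC cS') cC.
congr compact; apply/seteqP; split=> x /=.
- case=> y [c' [[c [s [Cc Ss ->]]] Cc' ->]]; exists c, s, c'; split=> //.
  case: Ss => [[Ss|[s' Ss' <-]]|->]; first exact: Or31.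
  - by apply: Or32; rewrite invgK.
  - exact: Or33.
- case=> c [s [c' [Cc Cc' Ss ->]]]; exists (c * s), c'; split=> //.
  exists c, s; split=> //; case: Ss => [Ss|Ss|->]; last by right.
  + by left; left.
  + by left; right; exists s^-1 => //; rewrite invgK.
Qed.

(** The elements whose coset can be reached from [C] form a subgroup containing [C] and [S]. *)
Lemma coset_connected A B : exists n, walk coset_adj n A B.
Proof.
have walk_act g n X Y : walk coset_adj n X Y ->
    walk coset_adj n (coset_act g X) (coset_act g Y).
  elim: n X => [|n IHn] X /=; first by move=> ->.
  by case=> X' XX' /IHn wn; exists (coset_act g X') => //; apply: coset_act_adj.
have step g : coset_steps g ->
    exists n, walk coset_adj n (coset_of 1) (coset_of g).
  move=> st; have [Cg|nCg] := pselect (C g).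
    by exists 0%N; apply/coset_of_eqP; rewrite invg1 mul1g.
  exists 1%N, (coset_of g) => //; apply/coset_adj_of.
  by rewrite invg1 mul1g.
pose M := [set g | exists n, walk coset_adj n (coset_of 1) (coset_of g)].
have MT : M = setT.
  apply: gen; last 2 first.
  - by move=> c /coset_steps_subgroup; apply: step.
  - move=> s Ss; apply: step; exists 1, s, 1; rewrite mul1g mulg1.
    by split=> //; [apply: subgroup1|apply: subgroup1|apply: Or31].
  split=> [|x y [m wm] [n wn]|x [n wn]].
  - by exists 0%N.
  - exists (m + n)%N; apply: walk_cat wm _.
    by have := walk_act x _ _ _ wn; rewrite !coset_act_of mulg1.
  - exists n; apply: (walk_rev coset_adj_sym).
    by have := walk_act x^-1 _ _ _ wn; rewrite !coset_act_of mulg1 mulVg.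
have [g ->] := coset_of_surj A; have [h ->] := coset_of_surj B.
have [n wn] : M (g^-1 * h) by rewrite MT.
by exists n; have := walk_act g _ _ _ wn; rewrite !coset_act_of mulg1 mulVKg.
Qed.

Lemma coset_graph : cayley_abels_graph coset_adj coset_act.
Proof.
split.
- exact: coset_adj_sym.
- by move=> X [].
- move=> X; have [g ->] := coset_of_surj X.
  have [F _ FE] := compact_finite_lcosets oC (subgroup1 sC) coset_steps_compact.
  apply: (@sub_finite_set _ _ [set coset_of (g * f) | f in [set` F]]).
    move=> Y /=; have [h ->] := coset_of_surj Y.
    move=> /coset_adj_of[_ /FE[f fF Cf]]; exists f => //.
    by apply/coset_of_eqP; rewrite invgM -mulgA.
  exact/finite_image/finite_seq.
- by exists (coset_of 1).
- exact: coset_connected.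
- by move=> X; have [g ->] := coset_of_surj X; rewrite coset_act_of mul1g.
- by move=> g h X; have [k ->] := coset_of_surj X; rewrite !coset_act_of mulgA.
- exact: coset_act_adj.
- move=> X Y; have [h ->] := coset_of_surj X; have [k ->] := coset_of_surj Y.
  by exists (k * h^-1); rewrite coset_act_of mulgVK.
(* The stabilizer of [hC] is the conjugate of [C] by [h]: as an image it is compact, and below, as a
   preimage, open. *)
- move=> X; have [h ->] := coset_of_surj X.
  have -> : [set g | coset_act g (coset_of h) = coset_of h] =
      [set h * x * h^-1 | x in C].
    apply/seteqP; split=> [x|_ [c Cc <-]] /=; rewrite coset_act_of.
      move=> /esym/coset_of_eqP Cx; exists (h^-1 * (x * h)) => //.
      by rewrite mulVKg mulgK.
    apply/coset_of_eqP.
    by rewrite mulgVK invgM mulgVK; apply: subgroupV.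
  apply: continuous_compact cC; apply/continuous_subspaceT/continuous_mulg.
    exact: continuous_lmulg.
  exact: cst_continuous.
- move=> X; have [h ->] := coset_of_surj X.
  have -> : [set g | coset_act g (coset_of h) = coset_of h] =
      (fun x => h^-1 * (x * h)) @^-1` C.
    apply/seteqP; split=> x /=; rewrite coset_act_of.
      by move=> /esym/coset_of_eqP.
    by move=> Cx; apply/esym/coset_of_eqP.
  apply: open_preimage oC; apply: continuous_mulg; first exact: cst_continuous.
  exact: continuous_rmulg.
Qed.

Definition coset_dist := cag_dist coset_adj coset_act (coset_of 1).

Lemma coset_dist_geodesic : geodesic_metric coset_dist.
Proof. exact: cag_dist_geodesic coset_graph _. Qed.

Lemma coset_dist_eq0 g h : coset_dist g h = 0%N <-> C (g^-1 * h).
Proof.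
rewrite /coset_dist /cag_dist !coset_act_of !mulg1 -coset_of_eqP.
split=> [/(walk_dist_eq0 coset_connected) //|->].
exact: geo_refl (walk_dist_geodesic (cag_sym coset_graph) coset_connected) _.
Qed.

Lemma coset_dist_le1 g h : (coset_dist g h <= 1)%N <-> coset_steps (g^-1 * h).
Proof.
have conn := coset_connected.
rewrite /coset_dist /cag_dist !coset_act_of !mulg1; split.
  case/(walk_dist_le1 conn) => [/coset_of_eqP|/coset_adj_of[]//].
  exact: coset_steps_subgroup.
move=> st; have [Cgh|nC] := pselect (C (g^-1 * h)).
  by apply: (@leq_trans 0) => //; apply: walk_dist_le => //; apply/coset_of_eqP.
exact/(walk_dist_adj conn)/coset_adj_of.
Qed.

End CosetGraph.

(** * The Bass-Serre tree of an HNN extension *)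

Section HalfSpaces.
Local Open Scope group_scope.
Variables (A G : groupType) (C : set A) (alpha : A -> A) (i : A -> G) (t : G).
Hypothesis sC : subgroup C.
Hypothesis pres : hnn_presented C alpha i t.

Let eval_rel u v : hnn_rel C alpha u v -> hnn_eval i t u = hnn_eval i t v.
Proof.
move=> uv; apply/pres.2; have := hnn_eq_rel [::] [::] uv.
by rewrite !cats0.
Qed.

Lemma hnn_base1 : i 1 = 1.
Proof. by have := eval_rel (hnn_rel_one C alpha); rewrite /= mulg1. Qed.

Lemma hnn_baseM a b : i (a * b) = i a * i b.
Proof. by have := eval_rel (hnn_rel_mul C alpha a b); rewrite /= !mulg1. Qed.

Lemma hnn_baseV a : i a^-1 = (i a)^-1.
Proof. by apply: (mulgI (i a)); rewrite -hnn_baseM !mulgV hnn_base1. Qed.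

Lemma hnn_conj c : C c -> t^-1 * i c * t = i (alpha c).
Proof. by move=> /(hnn_rel_conj alpha)/eval_rel; rewrite /= !mulg1 mulgA. Qed.

Lemma hnn_edge_subgroup : subgroup (i @` C).
Proof.
split.
- by exists 1; [apply: subgroup1|apply: hnn_base1].
- move=> _ _ [a Ca <-] [b Cb <-]; exists (a * b); first exact: subgroupM.
  exact: hnn_baseM.
- move=> _ [a Ca <-]; exists a^-1; first exact: subgroupV.
  exact: hnn_baseV.
Qed.
Let sD := hnn_edge_subgroup.

(* Words act on G x bool on the right; the second component counts, modulo 2,
   the traversals of the edge C of the Bass-Serre tree. This respects the
   defining relations, so it makes sense for elements of G, without normal
   forms. *)
Definition traverse (s : G * bool) (l : hnn_letter A) : G * bool :=
  match l with
  | Base a => (s.1 * i a, s.2)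
  | Stable => (s.1 * t, s.2 (+) `[< (i @` C) s.1 >])
  | StableInv => (s.1 * t^-1, s.2 (+) `[< (i @` C) (s.1 * t^-1) >])
  end.

Lemma traverse_rel u v s :
  hnn_rel C alpha u v -> foldl traverse s u = foldl traverse s v.
Proof.
case: s => g b; case=> [|a b'|||c Cc] /=.
- by rewrite hnn_base1 mulg1.
- by rewrite hnn_baseM mulgA.
- by rewrite mulgK addbK.
- by rewrite mulgVK addbK.
(* The two crossings in [t^-1 c t] are tested at [g t^-1] and [g t^-1 c], which lie in the edge
   group together, so they cancel. *)
- rewrite -(hnn_conj Cc) !mulgA; congr (_, _).
  have -> : `[< (i @` C) (g * t^-1 * i c) >] = `[< (i @` C) (g * t^-1) >].
    by apply: asbool_equiv_eq; apply: subgroupMr => //; exists c.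
  exact: addbK.
Qed.

Lemma traverse_eq u v s :
  hnn_eq C alpha u v -> foldl traverse s u = foldl traverse s v.
Proof.
move=> uv; elim: uv s => {u v} [w1 w2 u v uv|w|u v _ IH|u v w _ IH1 _ IH2] s //.
- by rewrite !foldl_cat (traverse_rel _ uv).
- by rewrite IH1.
Qed.

Lemma traverse_fst w s : (foldl traverse s w).1 = s.1 * hnn_eval i t w.
Proof.
elim: w s => [|l w IHw] s /=; first by rewrite mulg1.
by rewrite IHw mulgA; case: l.
Qed.

(** The edge group fixes the edge [C], so translating a path by it preserves the crossings. *)
Lemma traverse_edge_mull d w g b : (i @` C) d ->
  (foldl traverse (d * g, b) w).2 = (foldl traverse (g, b) w).2.
Proof.
move=> Dd; elim: w g b => [|l w IHw] g b //=.
have Dg x : `[< (i @` C) (d * x) >] = `[< (i @` C) x >].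
  exact/asbool_equiv_eq/subgroupMl.
by case: l => [a||] /=; rewrite -mulgA ?Dg IHw.
Qed.

Let word (g : G) : hnn_word A := projT1 (cid (pres.1 g)).

Let eval_word g : hnn_eval i t (word g) = g.
Proof. exact: projT2 (cid (pres.1 g)). Qed.

(* The indicator of the half of the Bass-Serre tree beyond the edge C. *)
Definition halfspace (g : G) : bool := (foldl traverse (1, false) (word g)).2.

Lemma halfspace_eval w :
  halfspace (hnn_eval i t w) = (foldl traverse (1, false) w).2.
Proof. by congr snd; apply: traverse_eq; apply/pres.2/eval_word. Qed.

Lemma halfspace1 : halfspace 1 = false.
Proof. by rewrite (halfspace_eval [::]). Qed.

Let halfspace_rcons g l : halfspace (g * hnn_letter_val i t l) =
  (traverse (g, halfspace g) l).2.
Proof.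
have -> : g * hnn_letter_val i t l = hnn_eval i t (word g ++ [:: l]).
  rewrite -[in LHS](eval_word g); elim: (word g) => [|l' w IHw] /=.
    by rewrite mul1g mulg1.
  by rewrite -mulgA IHw.
rewrite halfspace_eval foldl_cat /=.
suff -> : foldl traverse (1, false) (word g) = (g, halfspace g) by [].
by rewrite [LHS]surjective_pairing traverse_fst mul1g eval_word.
Qed.

Lemma halfspace_base g a : halfspace (g * i a) = halfspace g.
Proof. exact: halfspace_rcons g (Base a). Qed.

Lemma halfspace_stable g :
  halfspace (g * t) = halfspace g (+) `[< (i @` C) g >].
Proof. exact: halfspace_rcons g (Stable A). Qed.

Lemma halfspace_edge_mull d g : (i @` C) d -> halfspace (d * g) = halfspace g.
Proof.
case=> c Cc <-; rewrite -{1}(eval_word g).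
rewrite (halfspace_eval (Base c :: word g)) /= mul1g -[i c]mulg1.
by apply: traverse_edge_mull; exists c.
Qed.

(** True when the tree vertex [gA] lies beyond the edge [hC], which joins [hA] to [htA]. *)
Definition side (h g : G) : bool := halfspace (h^-1 * g).

Lemma side_base h g a : side h (g * i a) = side h g.
Proof. by rewrite /side mulgA halfspace_base. Qed.

Lemma side_stable h g :
  side h (g * t) = side h g (+) `[< (i @` C) (h^-1 * g) >].
Proof. by rewrite /side mulgA halfspace_stable. Qed.

Lemma side_edge h h' g : (i @` C) (h^-1 * h') -> side h' g = side h g.
Proof.
move=> Dh; rewrite /side -(halfspace_edge_mull (h'^-1 * g) Dh).
by rewrite -mulgA mulVKg.
Qed.

Lemma side_self h : side h h = false.
Proof. by rewrite /side mulVg halfspace1. Qed.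

End HalfSpaces.

(** * Geodesics and the four-point condition along the tree *)

Section TreeOfSpaces.
Local Open Scope group_scope.
Variables (A G : groupType) (C : set A) (alpha : A -> A) (i : A -> G) (t : G).
Hypothesis sC : subgroup C.
Hypothesis pres : hnn_presented C alpha i t.
Hypothesis inj_i : injective i.
Variables (dA : A -> A -> nat) (dG : G -> G -> nat).
Hypotheses (gdA : geodesic_metric dA) (gdG : geodesic_metric dG).
Hypothesis dG_mulg : forall k g h, dG (k * g) (k * h) = dG g h.
Hypothesis dA_eq0 : forall a b, dA a b = 0%N <-> C (a^-1 * b).
Hypothesis dG_eq0 : forall g h, dG g h = 0%N <-> (i @` C) (g^-1 * h).
Hypothesis dA_edge : forall a c c' c'', C c -> C c' -> C c'' ->
  (dA a (a * (c * alpha c' * c'')) <= 1)%N.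
Hypothesis dA_dG : forall a g, (dA a (a * g) <= 1)%N -> 
  forall x, (dG x (x * i g) <= 1)%N.
Hypothesis dG_step : forall x y, (dG x y <= 1)%N ->
  [\/ exists2 a, y = x * i a & forall b, (dA b (b * a) <= 1)%N,
      exists c c', [/\ C c, C c' & y = x * i c * t * i c']
    | exists c c', [/\ C c, C c' & x = y * i c * t * i c']].
Hypothesis dG_stable : forall x, (dG x (x * t) <= 1)%N.

Notation side := (side pres).
Let sD := hnn_edge_subgroup sC pres.

Lemma dist0_side h x y : dG x y = 0%N -> side h x = side h y.
Proof.
by move/dG_eq0 => [c Cc xy]; rewrite -(mulVKg x y) -xy (side_base sC).
Qed.

Lemma side_dist0 h x : dG h x = 0%N -> side h x = false.
Proof. by move/(dist0_side h) => <-; apply: (side_self sC). Qed.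

Lemma dist_edge x c : C c -> dG x (x * i c) = 0%N.
Proof. by move=> Cc; apply/dG_eq0; rewrite mulKg; exists c. Qed.

Lemma side_beyond x c c' : C c -> side (x * i c) (x * i c * t * i c').
Proof.
move=> Cc; rewrite (side_base sC) (side_stable sC) (side_self sC) mulVg.
by rewrite asboolT //; apply: subgroup1 sD.
Qed.

(** Steps inside a coset of [A] keep the side, and a backward step over the edge [hC] would end at
    the vertex [hC], on the near side. *)
Lemma crossing h x y : (dG x y <= 1)%N -> ~~ side h x -> side h y ->
  dG h x = 0%N /\ exists c c', [/\ C c, C c' & y = x * i c * t * i c'].
Proof.
move=> dxy nhx hy.
case: (dG_step dxy) => [[a yE _]|[c [c' [Cc Cc' yE]]]|[c [c' [Cc Cc' xE]]]].
- by move: hy; rewrite yE (side_base sC) (negbTE nhx).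
- split; last by exists c, c'.
  move: hy; rewrite yE (side_base sC) (side_stable sC) (side_base sC).
  rewrite (negbTE nhx) /= => /asboolP.
  rewrite mulgA => Dhx; apply/dG_eq0; apply: (subgroupMr sD _ _).1 Dhx.
  by exists c.
- move: nhx; rewrite xE (side_base sC) (side_stable sC) (side_base sC) hy.
  move=> /= /negbNE/asboolP/dG_eq0/side_dist0.
  by rewrite (side_base sC) hy.
Qed.

(* The vertex hC of the coset graph separates the two sides of the edge hC. *)
Lemma side_cut h x y : side h x != side h y -> dG x y = (dG x h + dG h y)%N.
Proof.
move=> hxy; apply/eqP; rewrite eqn_leq (geo_triangle gdG) /=.
wlog {hxy} [nhx hy] : x y / ~~ side h x /\ side h y => [hw|].
  move: hxy; case hx : (side h x); case hy : (side h y) => // _.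
  - rewrite addnC (geo_sym gdG h) (geo_sym gdG x h) (geo_sym gdG x).
    by apply: hw; rewrite hx hy.
  - by apply: hw; rewrite hx hy.
move dxy: (dG x y) => n; elim: n x nhx dxy => [|n IHn] x nhx dxy.
  by move: nhx; rewrite (dist0_side h dxy) hy.
have [|x1 dx1 dx1y] := @geo_interp _ _ gdG x y 1; first by rewrite dxy.
case hx1 : (side h x1).
  have [|hx _] := crossing _ nhx hx1; first by rewrite dx1.
  rewrite (geo_sym gdG) hx -dxy; have := geo_triangle gdG h x y.
  by rewrite hx.
have := IHn x1 (negbT hx1); rewrite dx1y dxy subn1 => /(_ erefl).
by have := geo_triangle gdG x x1 h; rewrite dx1; lia.
Qed.

(** A geodesic between points that no edge separates cannot leave their coset of [A]. After a
    forward crossing it would return through a cut vertex at distance 0 from [u]; after a backward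
    crossing it would come back over the same edge to a neighbour of [u]. *)
Lemma same_side_step u v u1 : (forall h, side h u = side h v) ->
  (dG u u1 <= 1)%N -> dG u v = (dG u1 v).+1 ->
  exists2 a, u1 = u * i a & forall b, (dA b (b * a) <= 1)%N.
Proof.
move=> uv du1 duv.
case: (dG_step du1) => [//|[c [c' [Cc Cc' u1E]]]|[c [c' [Cc Cc' uE]]]].
- have hu := dist_edge u Cc; set h := u * i c in hu u1E.
  have hu1 : side h u1 by rewrite u1E; apply: side_beyond.
  have nhv : side h v = false.
    by rewrite -uv; apply: side_dist0; rewrite (geo_sym gdG).
  have := @side_cut h u1 v; rewrite hu1 nhv => /(_ isT).
  have := geo_triangle gdG u h v; lia.
- have hu1 := dist_edge u1 Cc; set h := u1 * i c in hu1 uE.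
  have nhu1 : side h u1 = false by apply: side_dist0; rewrite (geo_sym gdG).
  have hu : side h u by rewrite uE; apply: side_beyond.
  have hv : side h v by rewrite -uv.
  have u1v : dG u1 v <> 0%N by move/(dist0_side h); rewrite hv nhu1.
  (* The next point [u2] must be beyond [h] again: otherwise the cut vertex [h], at distance 0 from
     [u1], would lie between [u2] and [v]. *)
  have [|u2 du12 du2] := @geo_interp _ _ gdG u1 v 1; first by lia.
  case hu2 : (side h u2); last first.
    have := @side_cut h u2 v; rewrite hu2 hv => /(_ isT).
    by have := geo_triangle gdG u1 h v; lia.
  have [|||_ [c2 [c3 [Cc2 Cc3 u2E]]]] := @crossing h u1 u2.
  - by rewrite du12.
  - by rewrite nhu1.
  - by [].
  have Ccc2 : C (c^-1 * c2) by apply: subgroupM => //; apply: subgroupV.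
  (* Conjugation by [t] turns the detour through [u1] into an element of [C alpha(C) C], which is a
     single step from [u]. *)
  have u2u : u2 = u * i (c'^-1 * alpha (c^-1 * c2) * c3).
    rewrite !(hnn_baseM pres) !(hnn_baseV pres) -(hnn_conj pres Ccc2).
    rewrite (hnn_baseM pres) (hnn_baseV pres) u2E uE !mulgA.
    by rewrite mulgK mulgK mulgK.
  have := @dA_dG 1 (c'^-1 * alpha (c^-1 * c2) * c3) _ u.
  rewrite -u2u => /(_ (dA_edge _ _ _ _)) => /(_ (subgroupV sC Cc') Ccc2 Cc3).
  by have := geo_triangle gdG u u2 v; lia.
Qed.

(** Steps in [A] are steps in [G]; conversely no edge separates points of [i A], so geodesics
    between them consist of steps in [A]. *)
Lemma base_isometry a b : dG (i a) (i b) = dA a b.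
Proof.
apply/eqP; rewrite eqn_leq; apply/andP; split.
  move dab: (dA a b) => n; elim: n a dab => [|n IHn] a dab.
    rewrite leqn0; apply/eqP/dG_eq0; exists (a^-1 * b); first exact/dA_eq0.
    by rewrite (hnn_baseM pres) (hnn_baseV pres).
  have [|a1 da1 da1b] := @geo_interp _ _ gdA a b 1; first by rewrite dab.
  have := geo_triangle gdG (i a) (i a1) (i b).
  have := IHn a1; rewrite da1b dab subn1 => /(_ erefl).
  have := @dA_dG a (a^-1 * a1) _ (i a).
  by rewrite mulVKg da1 -(hnn_baseM pres) mulVKg => /(_ isT); lia.
move dab: (dG (i a) (i b)) => n; elim: n a dab => [|n IHn] a dab.
  rewrite leqn0; apply/eqP/dA_eq0.
  move: dab => /dG_eq0[c Cc]; rewrite -(hnn_baseV pres) -(hnn_baseM pres).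
  by move/inj_i <-.
have [|x dx dxb] := @geo_interp _ _ gdG (i a) (i b) 1; first by rewrite dab.
have [||| a' xE da'] := @same_side_step (i a) (i b) x.
- by move=> h; rewrite -[i a]mul1g -[i b]mul1g !(side_base sC).
- by rewrite dx.
- by lia.
move: xE; rewrite -(hnn_baseM pres) => xE.
have := IHn (a * a'); rewrite -xE dxb dab subn1 => /(_ erefl).
by have := geo_triangle gdA a (a * a') b; have := da' a; lia.
Qed.

Lemma same_side_coset u v : (forall h, side h u = side h v) ->
  exists a, v = u * i a.
Proof.
move duv: (dG u v) => n; elim: n u duv => [|n IHn] u duv uv.
  by move: duv => /dG_eq0[c Cc uvE]; exists c; rewrite uvE mulVKg.
have [|x dx dxv] := @geo_interp _ _ gdG u v 1; first by rewrite duv.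
have [||a xE _] := @same_side_step u v x uv; first by rewrite dx.
  by lia.
have [||b ->] := IHn x; first by rewrite dxv duv subn1.
  by move=> h; rewrite -uv xE (side_base sC).
by exists (a * b); rewrite (hnn_baseM pres) xE mulgA.
Qed.

Variable e : nat.
Hypothesis fpA : four_point dA e.

(** The slack 8 allows each point to move by 1: every distance changes by at most 2, and two of them
    are added on either side. *)
Let F x y z w := (dG x z + dG y w <=
  maxn (dG x y + dG z w) (dG y z + dG x w) + (e + 8))%N.

Let F_rot x y z w : F x y z w -> F y z w x.
Proof.
rewrite /F (geo_sym gdG z x) (geo_sym gdG w x) (geo_sym gdG y x); lia.
Qed.

Lemma four_point_same_side x y z w :
  (forall h, [/\ side h x = side h y, side h x = side h z
               & side h x = side h w]) ->
  (dG x z + dG y w <= maxn (dG x y + dG z w) (dG y z + dG x w) + e)%N.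
Proof.
move=> al.
have [a yE] : exists a, y = x * i a.
  by apply: same_side_coset => h; case: (al h).
have [b zE] : exists a, z = x * i a.
  by apply: same_side_coset => h; case: (al h).
have [c wE] : exists a, w = x * i a.
  by apply: same_side_coset => h; case: (al h).
have d1 a' b' : dG (x * i a') (x * i b') = dA a' b'.
  by rewrite dG_mulg base_isometry.
have d0 a' : dG x (x * i a') = dA 1 a'.
  by rewrite -d1 (hnn_base1 pres) mulg1.
rewrite yE zE wE !d0 !d1; exact: fpA.
Qed.

(* When x is adjacent to everything else only through the edge xC, x is moved
   across that edge. *)
Let hat x y z w : G := if [&& side x y, side x z & side x w] then x * t else x.

Let hat_dist x y z w : (dG x (hat x y z w) <= 1)%N.
Proof. by rewrite /hat; case: ifP => // _; rewrite (geo_refl gdG). Qed.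

Let hat_side k x y z w : side k (hat x y z w) =
  side k x || [&& `[< (i @` C) (k^-1 * x) >], side k y, side k z & side k w].
Proof.
rewrite /hat; have [Dkx|nDkx] := pselect ((i @` C) (k^-1 * x)).
  rewrite (asboolT Dkx) !(side_edge sC pres _ Dkx) /=.
  have nkx : side k x = false by apply/side_dist0/dG_eq0.
  by case: ifP => _; rewrite ?(side_stable sC) nkx ?(asboolT Dkx).
rewrite (asboolF nDkx) orbF; case: ifP => // _.
by rewrite (side_stable sC) (asboolF nDkx) addbF.
Qed.

(** Here [x] already is the cut vertex, so moving it to [h] gains nothing. *)
Let stuck h x y z w := dG h x = 0%N /\ [/\ side h y, side h z & side h w].

(** Replacing each point by its [hat] crosses exactly the edges at which it is stuck; afterwards no
    edge separates the four points. *)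
Lemma four_point_stuck x y z w :
  (forall h, [\/ [/\ side h x = side h y, side h x = side h z
               & side h x = side h w],
     stuck h x y z w, stuck h y z w x | stuck h z w x y \/ stuck h w x y z]) ->
  F x y z w.
Proof.
move=> st.
have := @four_point_same_side
  (hat x y z w) (hat y z w x) (hat z w x y) (hat w x y z).
have near x1 x2 x3 x4 y1 y2 y3 y4 :
    let hx := hat x1 x2 x3 x4 in let hy := hat y1 y2 y3 y4 in
    (dG hx hy <= dG x1 y1 + 2)%N /\ (dG x1 y1 <= dG hx hy + 2)%N.
  move=> hx hy; have := hat_dist x1 x2 x3 x4.
  have := hat_dist y1 y2 y3 y4; rewrite -/hx -/hy.
  have := geo_triangle gdG hx x1 hy; have := geo_triangle gdG x1 y1 hy.
  have := geo_triangle gdG x1 hx y1; have := geo_triangle gdG hx hy y1.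
  by rewrite (geo_sym gdG hx x1) (geo_sym gdG hy y1); lia.
have [xy xy'] := near x y z w y z w x; have [xz xz'] := near x y z w z w x y.
have [xw xw'] := near x y z w w x y z; have [yz yz'] := near y z w x z w x y.
have [yw yw'] := near y z w x w x y z; have [zw zw'] := near z w x y w x y z.
move=> hatF; rewrite /F.
suff /hatF : forall h, [/\ side h (hat x y z w) = side h (hat y z w x),
    side h (hat x y z w) = side h (hat z w x y)
  & side h (hat x y z w) = side h (hat w x y z)].
  by lia.
move=> h.
have D0 u : dG h u = 0%N -> `[< (i @` C) (h^-1 * u) >].
  by move=> /dG_eq0 ?; apply/asboolP.
have Ds u : `[< (i @` C) (h^-1 * u) >] -> side h u = false.
  by move=> /asboolP ?; apply/side_dist0/dG_eq0.
(* If all sides agree and one of the points is at [hC], then all four are on the near side and no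
   [hat] crosses this edge. *)
rewrite !hat_side; case: (st h) => [[<- <- <-]|s|s|[s|s]].
- case: (boolP `[< (i @` C) (h^-1 * x) >]) => [/Ds->|_];
  case: (boolP `[< (i @` C) (h^-1 * y) >]);
  case: (boolP `[< (i @` C) (h^-1 * z) >]);
  case: (boolP `[< (i @` C) (h^-1 * w) >]);
  by rewrite ?andbF ?orbF ?andbb ?orbb.
- by case: s => /D0 -> [-> -> ->]; rewrite orbT.
- by case: s => /D0 -> [-> -> ->]; rewrite !orbT.
- by case: s => /D0 -> [-> -> ->]; rewrite !orbT.
- by case: s => /D0 -> [-> -> ->]; rewrite !orbT.
Qed.

(** The induction measure: it drops when a point moves to a cut vertex at positive distance. *)
Let total x y z w :=
  (dG x y + dG x z + dG x w + dG y z + dG y w + dG z w)%N.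

Let total_rot x y z w : total y z w x = total x y z w.
Proof.
by rewrite /total (geo_sym gdG y x) (geo_sym gdG z x) (geo_sym gdG w x); lia.
Qed.

(* Moving a point separated by h from the three others to h changes the three
   sums of the four-point condition by the same amount. *)
Let F_lone n : (forall x y z w, (total x y z w < n)%N -> F x y z w) ->
  forall h x y z w, total x y z w = n ->
  side h y = ~~ side h x -> side h z = ~~ side h x -> side h w = ~~ side h x ->
  ~ stuck h x y z w -> F x y z w.
Proof.
move=> IH h x y z w nE hy hz hw nst.
have [] := (@side_cut h x y, @side_cut h x z, @side_cut h x w).
rewrite hy hz hw; case hx: (side h x) => -[/(_ isT) dy /(_ isT) dz] /(_ isT) dw.
(* At positive distance [h] replaces [x] in the induction; at distance 0, [x] is on the near side
   and hence stuck. *)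
all: have [hx0|hx0] := posnP (dG x h).
all: try by have := IH h y z w; move: nE; rewrite /total /F; lia.
- by move: hx; rewrite side_dist0 // (geo_sym gdG).
- by case: nst; split; [rewrite (geo_sym gdG)|rewrite hy hz hw hx].
Qed.

Theorem four_point_hnn : four_point dG (e + 8).
Proof.
suff Fn n x y z w : (total x y z w < n)%N -> F x y z w.
  by move=> x y z w; apply: (Fn (total x y z w).+1).
elim: n x y z w => [//|n IHn] x y z w; rewrite ltnS leq_eqVlt.
case/orP => [/eqP nE|]; last exact: IHn.
(* If [F] fails, every edge without a stuck point must have all four points on one side. *)
have [//|nF] := pselect (F x y z w); apply: four_point_stuck => h.
have [sx|nsx] := pselect (stuck h x y z w); first exact: Or42.
have [sy|nsy] := pselect (stuck h y z w x); first exact: Or43.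
have [sz|nsz] := pselect (stuck h z w x y); first by apply: Or44; left.
have [sw|nsw] := pselect (stuck h w x y z); first by apply: Or44; right.
apply: Or41.
have dif u v : (dG u v <= dG u h + dG v h)%N /\
    if side h u == side h v then True else dG u v = (dG u h + dG v h)%N.
  rewrite (geo_sym gdG v h); split; first exact: geo_triangle gdG _ _ _.
  by case: eqP => [//|/eqP/side_cut].
have nEy : total y z w x = n by rewrite total_rot.
have nEz : total z w x y = n by rewrite total_rot.
have nEw : total w x y z = n by rewrite total_rot.
have Fx := F_lone IHn nE _ _ _ nsx; have Fy := F_lone IHn nEy _ _ _ nsy.
have Fz := F_lone IHn nEz _ _ _ nsz; have Fw := F_lone IHn nEw _ _ _ nsw.
have rot1 := @F_rot w x y z; have rot2 := @F_rot z w x y.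
have rot3 := @F_rot y z w x.
(* A lone point is treated by [F_lone] up to rotation. In a split into two pairs, the two sums of
   separated distances are equal and dominate the third. *)
case hx : (side h x); case hy : (side h y);
case hz : (side h z); case hw : (side h w) => //; case: nF;
first [by apply: Fx; rewrite ?hx ?hy ?hz ?hw
      |by apply/rot1/rot2/rot3/Fy; rewrite ?hx ?hy ?hz ?hw
      |by apply/rot1/rot2/Fz; rewrite ?hx ?hy ?hz ?hw
      |by apply/rot1/Fw; rewrite ?hx ?hy ?hz ?hw
      |move: (dif x y) (dif x z) (dif x w) (dif y z) (dif y w) (dif z w);
       rewrite /F hx hy hz hw /=; lia].
Qed.

End TreeOfSpaces.

(** * Topology of the HNN extension *)

Section OpenEmbedding.
Variables (X Y : topologicalType) (f : X -> Y).
Hypothesis inj_f : injective f.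
Hypothesis open_f : forall U : set X, open U -> open (f @` U).

Lemma open_embedding_inv (x0 : X) : exists2 g : Y -> X,
  cancel f g & {within range f, continuous g}.
Proof.
pose g y := xget x0 [set x | f x = y].
have gK : cancel f g.
  by move=> x; rewrite /g; case: xgetP => [x' _ /inj_f //|/(_ x erefl) []].
exists g => //; apply/subspace_continuousP => _ [x _ <-] W nW.
move: (nW : nbhs (g (f x)) W).
rewrite gK nbhsE => -[U [oU Ux] UW].
rewrite /nbhs /= /within /=.
apply: filterS (open_nbhs_nbhs (conj (open_f oU) (imageP f Ux))).
by move=> _ [z Uz <-] _; apply: UW; rewrite /from_subspace gK.
Qed.

Lemma compact_open_embedding (K : set X) : compact (f @` K) -> compact K.
Proof.
have [-> _|/set0P[x0 _]] := eqVneq K set0; first exact: compact0.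
have [g gK cg] := open_embedding_inv x0 => cK.
have -> : K = g @` (f @` K).
  rewrite image_comp; apply/seteqP; split=> [x Kx|_ [x Kx <-]] /=.
    by exists x => //=; rewrite gK.
  by rewrite gK.
apply: continuous_compact cK; apply: continuous_subspaceW cg.
exact: image_subset.
Qed.

End OpenEmbedding.

(** * Total disconnectedness passes to the HNN extension *)

Section TotallyDisconnected.
Local Open Scope group_scope.
Variables (A G : topologicalGroupType) (i : A -> G).
Hypothesis sub_i : subgroup (range i).
Hypothesis inj_i : injective i.
Hypothesis open_i : forall U : set A, open U -> open (i @` U).

Lemma open_subgroup_closed (H : set G) : subgroup H -> open H -> closed H.
Proof.
move=> sH oH; rewrite -(setCK H); apply: open_closedC; rewrite openE => g nHg.
have oD : open [set x | H (g^-1 * x)] by apply: open_lcoset.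
apply: filterS (open_nbhs_nbhs (conj oD _)) => [x /= Hgx Hx|].
  apply: nHg; rewrite -(mulVKg x g) -[x^-1 * g]invgK invgM invgK.
  by apply: subgroupM => //; apply: subgroupV.
by rewrite /= mulVg; apply: subgroup1.
Qed.

(** A connected set translated to contain 1 stays in the clopen subgroup [range i], and pulls back
    to a connected set of [A]. *)
Lemma open_embedding_totally_disconnected :
  totally_disconnected [set: A] -> totally_disconnected [set: G].
Proof.
move=> tdA x _; apply/seteqP; split=> [y [B [Bx _ cB] By]|_ ->]; last first.
  exact: connected_component_refl.
have [g gK cg] := open_embedding_inv inj_i open_i 1.
pose B' := [set x^-1 * b | b in B].
have cB' : connected B'.
  apply: (connected_continuous_connected cB).
  exact/continuous_subspaceT/continuous_lmulg.
have oR : open (range i) by apply: open_i; apply: openT.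
have B'1 : B' 1 by exists x => //; rewrite mulVg.
have B'E : B' `&` range i = B'.
  apply: cB'.
  - by exists 1; split=> //; apply: subgroup1 sub_i.
  - by exists (range i).
  - by exists (range i) => //; apply: open_subgroup_closed.
have B'i : B' `<=` range i by rewrite -B'E; apply: subIsetr.
have cgB : connected (g @` B').
  apply: (connected_continuous_connected cB').
  exact: continuous_subspaceW cg.
have : connected_component [set: A] (g 1) (g (x^-1 * y)).
  exists (g @` B'); last by exists (x^-1 * y) => //; exists y.
  by split=> //; exists 1.
rewrite tdA // => /= gE.
have [a _ ia] := B'i _ B'1.
have [|b _ ib] := B'i (x^-1 * y); first by exists y.
move: gE; rewrite -ia -ib !gK => ba; rewrite ba ia in ib.
by rewrite -(mulVKg x y) -ib mulg1.
Qed.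

End TotallyDisconnected.

Lemma locally_compact_open_compact_subgroup (G : topologicalGroupType)
  (C : set G) : subgroup C -> open C -> compact C -> locally_compact [set: G].
Proof.
move=> sC oC cC x _; rewrite withinET.
have -> : nbhs x = nbhs (x * 1)%g by rewrite mulg1.
exists [set x * y | y in C]%g.
  apply: open_nbhs_nbhs; split; last by exists 1%g => //; apply: subgroup1.
  suff -> : [set x * y | y in C]%g = [set y | C (x^-1 * y)%g].
    exact: open_lcoset.
  apply/seteqP; split=> [_ [y Cy <-]|y Cy] /=; first by rewrite mulKg.
  by exists (x^-1 * y)%g; rewrite ?mulVKg.
have cxC : compact [set x * y | y in C]%g.
  exact/(continuous_compact _ cC)/continuous_subspaceT/continuous_lmulg.
by split=> //; apply: compact_closed cxC; apply: topologicalGroup_hausdorff.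
Qed.

Lemma smallest_subgroup (G : groupType) (K : set G) :
  subgroup (smallest (@subgroup G) K).
Proof.
split=> [M [/subgroup1]|x y Kx Ky M sKM|x Kx M sKM] //.
- by apply: (subgroupM sKM.1); [apply: Kx|apply: Ky].
- by apply: (subgroupV sKM.1); apply: Kx.
Qed.

(** * The coset graphs of [A] and [G] *)

Section HnnGroup.
Local Open Scope group_scope.
Variables (R : realType) (A G : topologicalGroupType) (C : set A)
  (alpha : A -> A) (i : A -> G) (t : G).
Hypothesis hnn : hnn_extension C alpha i t.
Hypothesis A_tdlc : tdlc A.
Hypothesis C_compact : compact (i @` C).
Hypothesis C_open : open (i @` C).
Variable K : set A.
Hypothesis K_compact : compact K.
Hypothesis K_gen : smallest (@subgroup A) K = setT.

Let sC := hnn_subgroup hnn.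
Let pres := hnn_presentation hnn.
Let sD := hnn_edge_subgroup sC pres.

(** The preimage of [M] in [A] is a subgroup containing the generators [K], so [M] contains the
    value of every word. *)
Lemma hnn_subgroupT (M : set G) :
  subgroup M -> i @` K `<=` M -> M t -> M = setT.
Proof.
move=> sM KM Mt; have Mi a : M (i a).
  suff : smallest (@subgroup A) K `<=` i @^-1` M by rewrite K_gen; apply.
  apply: smallest_sub; last by move=> k Kk; apply: KM; exists k.
  split=> /= [|x y|x].
  - by rewrite (hnn_base1 pres); apply: subgroup1.
  - by rewrite (hnn_baseM pres) => Mx My; apply: subgroupM.
  - by rewrite (hnn_baseV pres) => Mx; apply: subgroupV.
apply/seteqP; split=> // g _; have [w <-] := pres.1 g.
elim: w => [|l w IHw] /=; first exact: subgroup1.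
apply: subgroupM => //; case: l => [a||] //=.
exact: subgroupV.
Qed.

Lemma hnn_compactly_generated : compactly_generated G.
Proof.
exists (i @` K `|` [set t]).
  apply: compactU; last exact: compact_set1.
  apply: continuous_compact K_compact.
  exact/continuous_subspaceT/hnn_continuous/hnn.
apply: hnn_subgroupT.
- exact: smallest_subgroup.
- by move=> x Kx M [_]; apply; left.
- by move=> M [_]; apply; right.
Qed.

(* With alpha(C) among the generators, the neighbours of a vertex across an edge
   of the tree are pairwise adjacent, so geodesics between points of a coset of
   A do not benefit from leaving it. *)
Let S_A : set A := K `|` alpha @` C.
Let S_G : set G := i @` S_A `|` [set t].

Let C_cpt : compact C.
Proof.
exact: compact_open_embedding (hnn_injective hnn) (hnn_open_map hnn) _
  C_compact.
Qed.

Let S_A_compact : compact S_A.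
Proof.
apply: compactU => //; apply: continuous_compact C_cpt.
by case: (hnn_iso hnn).
Qed.

Let S_G_compact : compact S_G.
Proof.
apply: compactU; last exact: compact_set1.
apply: continuous_compact S_A_compact.
exact/continuous_subspaceT/hnn_continuous/hnn.
Qed.

Let S_A_gen M : subgroup M -> C `<=` M -> S_A `<=` M -> M = setT.
Proof.
move=> sM _ SM; apply/seteqP; split=> // x _.
suff : smallest (@subgroup A) K `<=` M by rewrite K_gen; apply.
by apply: smallest_sub => // k Kk; apply: SM; left.
Qed.

Let S_G_gen M : subgroup M -> i @` C `<=` M -> S_G `<=` M -> M = setT.
Proof.
move=> sM _ SM; apply: hnn_subgroupT => //; last by apply: SM; right.
by move=> _ [k Kk <-]; apply: SM; left; exists k => //; left.
Qed.

Let graphA := coset_graph sC (hnn_open hnn) C_cpt S_A_compact S_A_gen.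
Let graphG := coset_graph sD C_open C_compact S_G_compact S_G_gen.
Let dA := coset_dist C S_A.
Let dG := coset_dist (i @` C) S_G.
Let gdA : geodesic_metric dA :=
  coset_dist_geodesic sC (hnn_open hnn) C_cpt S_A_compact S_A_gen.
Let gdG : geodesic_metric dG :=
  coset_dist_geodesic sD C_open C_compact S_G_compact S_G_gen.
Let dA_le1 a b : (dA a b <= 1)%N <-> coset_steps C S_A (a^-1 * b).
Proof. exact: (coset_dist_le1 sC S_A_gen). Qed.
Let dG_le1 g h : (dG g h <= 1)%N <-> coset_steps (i @` C) S_G (g^-1 * h).
Proof. exact: (coset_dist_le1 sD S_G_gen). Qed.
Let dA_eq0 a b : dA a b = 0%N <-> C (a^-1 * b).
Proof. exact: (coset_dist_eq0 sC (hnn_open hnn) C_cpt S_A_compact S_A_gen). Qed.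
Let dG_eq0 g h : dG g h = 0%N <-> (i @` C) (g^-1 * h).
Proof. exact: (coset_dist_eq0 sD C_open C_compact S_G_compact S_G_gen). Qed.
Let dG_mulg k g h : dG (k * g) (k * h) = dG g h.
Proof. exact: (cag_dist_mulg graphG). Qed.

Let dA_edge a c c' c'' : C c -> C c' -> C c'' ->
  (dA a (a * (c * alpha c' * c''))%g <= 1)%N.
Proof.
move=> Cc Cc' Cc''; apply/dA_le1; rewrite mulKg.
exists c, (alpha c'), c''; split=> //; apply: Or31; right; exists c' => //.
Qed.

Let dA_dG a g : (dA a (a * g)%g <= 1)%N -> forall x, (dG x (x * i g)%g <= 1)%N.
Proof.
move/dA_le1; rewrite mulKg => -[c [s [c' [Cc Cc' Ss ->]]]] x; apply/dG_le1.
rewrite mulKg !(hnn_baseM pres); exists (i c), (i s), (i c'); split=> //.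
case: Ss => [Ss|Ss|->].
- by apply: Or31; left; exists s.
- by apply: Or32; left; exists s^-1 => //; rewrite (hnn_baseV pres).
- by apply: Or33; rewrite (hnn_base1 pres).
Qed.

Let dG_step x y : (dG x y <= 1)%N ->
  [\/ exists2 a, y = x * i a & forall b, (dA b (b * a)%g <= 1)%N,
      exists c c', [/\ C c, C c' & y = x * i c * t * i c']
    | exists c c', [/\ C c, C c' & x = y * i c * t * i c']].
Proof.
move=> /dG_le1 [_ [s [_ [[c Cc <-] [c' Cc' <-] Ss xy]]]].
have {xy}yE : y = x * i c * s * i c' by rewrite -[y](mulVKg x) xy !mulgA.
have base a : coset_steps C S_A a -> s = i a ->
    exists2 a, y = x * i a & forall b, (dA b (b * a)%g <= 1)%N.
  move=> st sE; exists (c * a * c'); last first.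
    by move=> b; apply/dA_le1; rewrite mulKg; apply/coset_stepsM.
  by rewrite yE sE !(hnn_baseM pres) !mulgA.
have st1 a : [\/ S_A a, S_A a^-1 | a = 1] -> coset_steps C S_A a.
  move=> Sa; exists 1, a, 1; rewrite mul1g mulg1.
  by split=> //; apply: subgroup1 sC.
case: Ss => [[[a Sa ia]|st]|[[a Sa ia]|st]|s1].
- by apply: Or31; apply: (base a); [apply/st1/Or31|].
- by apply: Or32; exists c, c'; rewrite yE st.
- apply: Or31; apply: (base a^-1); [apply/st1/Or32|]; rewrite ?invgK //.
  by rewrite (hnn_baseV pres) ia invgK.
- apply: Or33; exists c'^-1, c^-1; split; try exact: subgroupV.
  by rewrite yE -st !(hnn_baseV pres) !mulgK.
- by apply: Or31; apply: (base 1); [apply/st1/Or33|rewrite (hnn_base1 pres)].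
Qed.

Let dG_stable x : (dG x (x * t)%g <= 1)%N.
Proof.
apply/dG_le1; rewrite mulKg; exists 1, t, 1; rewrite mul1g mulg1.
split=> //; [exact: subgroup1 sD|exact: subgroup1 sD|by apply: Or31; right].
Qed.

Let dG_iso a b : dG (i a) (i b) = dA a b.
Proof.
exact: (base_isometry sC pres (hnn_injective hnn) gdA gdG dA_eq0 dG_eq0 dA_edge
  dA_dG dG_step).
Qed.

Lemma hnn_four_point :
  (exists e, four_point (walk_dist (@coset_adj _ C S_A)) e) <->
  (exists e, four_point (walk_dist (@coset_adj _ (i @` C) S_G)) e).
Proof.
have eqA e := four_point_cag_dist graphA (coset_of C 1) e.
have eqG e := four_point_cag_dist graphG (coset_of (i @` C) 1) e.
split=> -[e fp].
  exists (e + 8)%N; apply/eqG; apply: (four_point_hnn sC pres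
    (hnn_injective hnn) gdA gdG dG_mulg dA_eq0 dG_eq0 dA_edge dA_dG dG_step
    dG_stable).
  exact/eqA.
have fpG : four_point dG e by apply/eqG.
have fpA : four_point dA e by move=> a b c d; rewrite -!dG_iso; apply: fpG.
by exists e; apply/eqA.
Qed.

Lemma hnn_tdlc : tdlc G.
Proof.
split; last exact: locally_compact_open_compact_subgroup sD C_open C_compact.
apply: (open_embedding_totally_disconnected _ (hnn_injective hnn)).
- split=> [|_ _ [a _ <-] [b _ <-]|_ [a _ <-]].
  + by exists 1 => //; apply: hnn_base1 pres.
  + by exists (a * b) => //; apply: hnn_baseM pres _ _.
  + by exists a^-1 => //; apply: hnn_baseV pres _.
- exact: hnn_open_map hnn.
- by case: A_tdlc.
Qed.

(** [cag_four_point] moves the condition from the given Cayley-Abels graph to the coset graph, where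
    [hnn_four_point] applies. *)
Lemma hnn_hyperbolic : hyperbolic R G <-> hyperbolic R A.
Proof.
have hypA := gromov_hyperbolic_graph R (cag_sym graphA) (cag_connected graphA).
have hypG := gromov_hyperbolic_graph R (cag_sym graphG) (cag_connected graphG).
split=> -[_ cg [V [adj [act [cag]]]]].
  move=> /(gromov_hyperbolic_graph R (cag_sym cag) (cag_connected cag)).
  move=> /(cag_four_point cag graphG)/hnn_four_point/hypA hyp.
  split=> //; first by exists K.
  by exists (coset_space C), (coset_adj S_A), (@coset_act _ C).
move=> /(gromov_hyperbolic_graph R (cag_sym cag) (cag_connected cag)).
move=> /(cag_four_point cag graphA)/hnn_four_point/hypG hyp.
split; [exact: hnn_tdlc|exact: hnn_compactly_generated|].
by exists (coset_space (i @` C)), (coset_adj S_G), (@coset_act _ (i @` C)).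
Qed.

End HnnGroup.

Theorem corollary3p6 (R : realType) (A G : topologicalGroupType) (C : set A)
    (alpha : A -> A) (i : A -> G) (t : G)
    (hnn : hnn_extension C alpha i t)
    (A_tdlc : tdlc A) (A_cg : compactly_generated A)
    (C_compact : compact (i @` C)) (C_open : open (i @` C)) :
  hyperbolic R G <-> hyperbolic R A.
Proof.
have [K cK gK] := A_cg.
exact: (hnn_hyperbolic R hnn A_tdlc C_compact C_open cK gK).
Qed.
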